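(* Let $(E,F)$ be a complex Finsler bundle, where $\pi:E\to M$ is a holomorphic vector bundle of rank $m$ over an $n$-dimensional complex manifold $M$, and let $\nabla$ be its partial Bott complex connection, with horizontal curvature form $\Omega$. Then the horizontal forms of Chern type $\mathcal{C}^h_j(\nabla)$, $j=0,\dots,m$, defined by $\det\left(I_m-\frac{1}{2\pi i}\Omega\right)=\sum_{j=0}^m\mathcal{C}^h_j(\nabla)$ with $\mathcal{C}^h_j(\nabla)$ of type $(j,j,0,0)$, are $d^{\prime\prime h}$-closed: $d^{\prime\prime h}\mathcal{C}^h_j(\nabla)=0$.
   Context: Coordinates: $(z^k)_{k=1}^n$ are local holomorphic coordinates on $M$, $(s_a)_{a=1}^m$ a local holomorphic frame of $E$, and $(z^k,\eta^a)$ the induced local coordinates on $E$ (the point is $\eta^a s_a(z)$); they change by $z'^k=z'^k(z)$, $\eta'^a=M^a_b(z)\eta^b$ with $M$ holomorphic and invertible. Write $\partial_k=\partial/\partial z^k$, $\dot\partial_a=\partial/\partial\eta^a$, $\dot\partial_{\overline a}=\partial/\partial\overline\eta^a$, and $E^*=E\setminus\{\text{zero section}\}$. Summation convention is used. Complex Finsler bundle: a pair $(E,F)$ with $F:E\to[0,\infty)$ such that (1) $F^2$ is smooth on $E^*$; (2) $F(z,\eta)=0$ iff $\eta=0$; (3) $F(z,\lambda\eta)=|\lambda|F(z,\eta)$ for all $\lambda\in\mathbb{C}\setminus\{0\}$; (4) the matrix $h_{a\overline b}=\dot\partial_a\dot\partial_{\overline b}(F^2)$ is positive definite on $E^*$.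 Chern–Finsler nonlinear connection: $N^a_k=h^{\overline c a}\,\partial_k\dot\partial_{\overline c}(F^2)$, where $(h^{\overline c a})$ is the inverse of $(h_{a\overline c})$. Set $\delta_k=\partial_k-N^a_k\dot\partial_a$ and $\delta_{\overline k}=\overline{\delta_k}$. It is known that $[\delta_j,\delta_k]=0$. The $\delta_k$ span the horizontal bundle $H'E$, and the $\dot\partial_a$ span the vertical bundle $V'E$, with $T'E=H'E\oplus V'E$. Partial Bott complex connection $\nabla$ of $(E,F)$: $\nabla_XY=v'[X,Y]$ for $X\in\Gamma(H'E)$, $Y\in\Gamma(V'E)$, where $v'$ is the vertical projection. Its connection form is $\omega=(\omega^a_b)$, $\omega^a_b=L^a_{bk}dz^k$, $L^a_{bk}=\dot\partial_b(N^a_k)$, and its horizontal curvature form is $\Omega=(\Omega^a_b)$, $\Omega^a_b=\Omega^a_{bj\overline k}\,dz^j\wedge d\overline z^k$, $\Omega^a_{bj\overline k}=-\delta_{\overline k}(L^a_{bj})$. Under a change of local coordinates and frame $\Omega$ changes by conjugation with the transition matrix, so the forms $\mathcal{C}^h_j(\nabla)$ are globally defined. Horizontal forms: $\mathcal{A}^{p,q,0,0}$ is the space of smooth complex forms on $E^*$ locally of the form $\varphi=\frac{1}{p!q!}\varphi_{I_p\overline{J_q}}(z,\eta)\,dz^{I_p}\wedge d\overline z^{J_q}$ (type $(p,q,0,0)$; coefficients may depend on $\eta$). The operator $d^{\prime\prime h}:\mathcal{A}^{p,q,0,0}\to\mathcal{A}^{p,q+1,0,0}$ is $$(d^{\prime\prime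 h}\varphi)_{I_p\overline{j_1}\dots\overline{j_{q+1}}}=(-1)^p\sum_{k=1}^{q+1}(-1)^{k-1}\delta_{\overline{j_k}}\big(\varphi_{I_p\overline{j_1}\dots\widehat{\overline{j_k}}\dots\overline{j_{q+1}}}\big).$$ *)

(* Defs.v *)
From HB Require Import structures.
From mathcomp Require Import all_boot all_order all_fingroup all_algebra.

Set Implicit Arguments.
Unset Strict Implicit.
Unset Printing Implicit Defensive.

Import Order.TTheory GRing.Theory Num.Theory.

Local Open Scope ring_scope.

(* The exterior algebra of K^N: u S is the coefficient of u along
   e_{s_1} /\ ... /\ e_{s_r}, where S = {s_1 < ... < s_r}. *)
Definition exterior (K : comNzRingType) (N : nat) :=
  {ffun {set 'I_N} -> K}.

HB.instance Definition _ K N := GRing.Zmodule.on (exterior K N).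

Section Exterior.
Context {K : comNzRingType} {N : nat}.
Implicit Types (A B S : {set 'I_N}) (u v w : exterior K N).

Definition inversions A B : nat := \sum_(i in A) \sum_(j in B) (j < i)%N.

Definition wedge u v : exterior K N :=
  [ffun S : {set 'I_N} => \sum_(A : {set 'I_N} | A \subset S)
     (-1) ^+ inversions A (S :\: A) * (u A * v (S :\: A))].

Definition ext1 : exterior K N := [ffun S : {set 'I_N} => (S == set0)%:R].

Definition ext_gen (i : 'I_N) : exterior K N :=
  [ffun S : {set 'I_N} => (S == [set i])%:R].

Lemma inversionsUl A B S :
  [disjoint A & B] ->
  inversions (A :|: B) S = (inversions A S + inversions B S)%N.
Proof. by move=> dAB; rewrite /inversions -bigU //; apply: eq_bigl => i; rewrite !inE. Qed.

Lemma inversionsUr A B S :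
  [disjoint A & B] ->
  inversions S (A :|: B) = (inversions S A + inversions S B)%N.
Proof.
move=> dAB; rewrite /inversions -big_split /=.
by apply: eq_bigr => i _; rewrite -bigU //; apply: eq_bigl => j; rewrite !inE.
Qed.

Lemma wedgeA : associative wedge.
Proof.
move=> u v w; apply/ffunP => S; rewrite !ffunE.
transitivity (\sum_(A : {set 'I_N} | A \subset S)
  \sum_(B : {set 'I_N} | B \subset S :\: A)
    (-1) ^+ (inversions A (S :\: A) + inversions B (S :\: A :\: B)) *
      (u A * v B * w (S :\: A :\: B))).
  apply: eq_bigr => A _; rewrite ffunE !mulr_sumr; apply: eq_bigr => B _.
  by rewrite exprD -!mulrA; congr (_ * _); rewrite mulrCA; congr (_ * _).
transitivity (\sum_(C : {set 'I_N} | C \subset S)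
  \sum_(A : {set 'I_N} | A \subset C)
    (-1) ^+ (inversions C (S :\: C) + inversions A (C :\: A)) *
      (u A * v (C :\: A) * w (S :\: C))); last first.
  apply: eq_bigr => C _; rewrite ffunE mulr_suml mulr_sumr.
  by apply: eq_bigr => A _; rewrite exprD -!mulrA.
rewrite [RHS](exchange_big_dep (fun A : {set 'I_N} => A \subset S)) /=; last first.
  by move=> C A CS AC; apply: subset_trans CS.
apply: eq_bigr => A AS.
rewrite [RHS](reindex_onto (fun B => A :|: B) (fun C => C :\: A)) /=; last first.
  by move=> C /andP[_ AC]; rewrite setDE setUIr setUCr setIT; apply/setUidPr.
apply: eq_big => [B|B BSA].
  apply/idP/idP.
    rewrite subsetD => /andP[BS dBA]; rewrite subUset AS BS subsetUl /=.
    by rewrite setDUl setDv set0U; apply/eqP/setDidPl.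
  move=> /andP[/andP[ABS _]] /eqP <-; apply: setSD; exact: ABS.
have /andP[BS dBA] : (B \subset S) && [disjoint B & A] by rewrite -subsetD.
have -> : (A :|: B) :\: A = B.
  by rewrite setDUl setDv set0U; apply/setDidPl.
have -> : S :\: (A :|: B) = S :\: A :\: B by rewrite setDDl.
congr (_ ^+ _ * _).
rewrite inversionsUl; last by rewrite disjoint_sym.
rewrite -{1}(setID (S :\: A) B).
have -> : (S :\: A) :&: B = B by apply/setIidPr.
rewrite inversionsUr; last first.
  by rewrite disjoint_sym disjoints_subset subsetDr.
by rewrite [RHS]addnC addnA.
Qed.

Lemma wedge1l : left_id ext1 wedge.
Proof.
move=> u; apply/ffunP => S; rewrite ffunE (bigD1 set0) ?sub0set //=.
rewrite big1 => [|A /andP[_ /negPf A0]]; last by rewrite ffunE A0 mul0r mulr0.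
by rewrite ffunE eqxx setD0 /inversions big_set0 expr0 !mul1r addr0.
Qed.

Lemma wedge1r : right_id ext1 wedge.
Proof.
move=> u; apply/ffunP => S; rewrite ffunE (bigD1 S) ?subxx //=.
rewrite big1 => [|A /andP[AS nAS]]; last first.
  rewrite ffunE setD_eq0; case: (boolP (S \subset A)) => SA.
    by rewrite eqEsubset AS SA in nAS.
  by rewrite !mulr0.
rewrite ffunE setDv eqxx /inversions big1 => [|i _]; last by rewrite big_set0.
by rewrite expr0 mul1r mulr1 addr0.
Qed.

Lemma wedgeDl : left_distributive wedge +%R.
Proof.
move=> u v w; apply/ffunP => S; rewrite !ffunE -big_split /=.
by apply: eq_bigr => A _; rewrite ffunE mulrDl mulrDr.
Qed.

Lemma wedgeDr : right_distributive wedge +%R.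
Proof.
move=> u v w; apply/ffunP => S; rewrite !ffunE -big_split /=.
by apply: eq_bigr => A _; rewrite ffunE !mulrDr.
Qed.

Lemma ext1_neq0 : ext1 != 0.
Proof.
apply/eqP => /ffunP h; have := h set0; rewrite !ffunE eqxx => /eqP.
by rewrite oner_eq0.
Qed.

HB.instance Definition _ := GRing.Zmodule_isNzRing.Build (exterior K N)
  wedgeA wedge1l wedge1r wedgeDl wedgeDr ext1_neq0.

Definition ext_scale (a : K) u : exterior K N :=
  [ffun S : {set 'I_N} => a * u S].

Lemma ext_scaleA (a b : K) u :
  ext_scale a (ext_scale b u) = ext_scale (a * b) u.
Proof. by apply/ffunP => S; rewrite !ffunE mulrA. Qed.

Lemma ext_scale1 : left_id 1 ext_scale.
Proof. by move=> u; apply/ffunP => S; rewrite ffunE mul1r. Qed.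

Lemma ext_scaleDr : right_distributive ext_scale +%R.
Proof. by move=> a u v; apply/ffunP => S; rewrite !ffunE mulrDr. Qed.

Lemma ext_scaleDl u : {morph ext_scale^~ u : a b / a + b}.
Proof. by move=> a b; apply/ffunP => S; rewrite !ffunE mulrDl. Qed.

HB.instance Definition _ := GRing.Zmodule_isLmodule.Build K (exterior K N)
  ext_scaleA ext_scale1 ext_scaleDr ext_scaleDl.

Lemma wedgeZl (a : K) u v : a *: (u * v) = (a *: u) * v.
Proof.
apply/ffunP => S; rewrite !ffunE mulr_sumr.
by apply: eq_bigr => A _; rewrite ffunE mulrCA -[a * _ * _]mulrA.
Qed.

Lemma wedgeZr (a : K) u v : a *: (u * v) = u * (a *: v).
Proof.
apply/ffunP => S; rewrite !ffunE mulr_sumr.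
by apply: eq_bigr => A _; rewrite ffunE mulrCA [a * (_ * _)]mulrCA.
Qed.

HB.instance Definition _ :=
  GRing.Lmodule_isLalgebra.Build K (exterior K N) wedgeZl.
HB.instance Definition _ :=
  GRing.Lalgebra_isAlgebra.Build K (exterior K N) wedgeZr.

End Exterior.

(* Horizontal (p, q)-covectors live in the exterior algebra on the 2n
   generators dz^1, ..., dz^n, dzbar^1, ..., dzbar^n, in this order. *)
Section HorizontalCovectors.
Context {K : comNzRingType} {n : nat}.
Implicit Types (S : {set 'I_(n + n)}) (u v : exterior K (n + n)).

Definition dz (j : 'I_n) : exterior K (n + n) := ext_gen (lshift n j).
Definition dzbar (k : 'I_n) : exterior K (n + n) := ext_gen (rshift n k).

Definition holo_part S : {set 'I_n} := [set i | lshift n i \in S].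
Definition anti_part S : {set 'I_n} := [set i | rshift n i \in S].

Definition has_type (p q : nat) u :=
  forall S, u S != 0 -> #|holo_part S| = p /\ #|anti_part S| = q.

Definition type_component (p q : nat) u : exterior K (n + n) :=
  [ffun S : {set 'I_(n + n)} =>
     if (#|holo_part S| == p) && (#|anti_part S| == q) then u S else 0].

Lemma type_component_type p q u : has_type p q (type_component p q u).
Proof.
move=> S; rewrite ffunE.
by case: ifP => [/andP[/eqP -> /eqP ->]|]; rewrite ?eqxx.
Qed.

(* u is a sum of covectors of types (j, j), j <= d. *)
Definition diagonal_le (d : nat) u :=
  forall S, u S != 0 ->
    #|holo_part S| = #|anti_part S| /\ (#|holo_part S| <= d)%N.

Lemma diagonal_le_sum d u :
  diagonal_le d u -> u = \sum_(j < d.+1) type_component j j u.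
Proof.
move=> ud; apply/ffunP => S; rewrite sum_ffunE.
have [uS0|/[dup] uS0 /ud[eS leS]] := eqVneq (u S) 0.
  by rewrite uS0 big1 // => j _; rewrite ffunE uS0 if_same.
rewrite (bigD1 (Ordinal (leS : (_ < d.+1)%N))) //= ffunE -eS eqxx /=.
rewrite big1 ?addr0 // => j jS; rewrite ffunE -eS andbb ifN //.
by apply: contra jS => /eqP jS; apply/eqP/val_inj.
Qed.

Lemma diagonal_le1 : diagonal_le 0 1.
Proof.
move=> S; rewrite ffunE; have [-> _|_] := eqVneq S set0; last by rewrite eqxx.
have -> : holo_part set0 = set0 by apply/setP => i; rewrite !inE.
have -> : anti_part set0 = set0 by apply/setP => i; rewrite !inE.
by rewrite cards0.
Qed.

Lemma diagonal_leD d u v :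
  diagonal_le d u -> diagonal_le d v -> diagonal_le d (u + v).
Proof.
move=> ud vd S; rewrite ffunE; have [->|/ud //] := eqVneq (u S) 0.
by rewrite add0r; apply: vd.
Qed.

Lemma diagonal_leZ d (a : K) u : diagonal_le d u -> diagonal_le d (a *: u).
Proof.
move=> ud S; rewrite ffunE; have [->|/ud //] := eqVneq (u S) 0.
by rewrite mulr0 eqxx.
Qed.

Lemma diagonal_le_sumr d (I : Type) (r : seq I) (P : pred I) (f : I -> _) :
  (forall i, P i -> diagonal_le d (f i)) ->
  diagonal_le d (\sum_(i <- r | P i) f i).
Proof.
move=> fd; elim/big_rec : _ => [S|i u Pi ud]; first by rewrite ffunE eqxx.
by apply: diagonal_leD => //; apply: fd.
Qed.

Lemma diagonal_leM d e u v :
  diagonal_le d u -> diagonal_le e v -> diagonal_le (d + e) (u * v).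
Proof.
move=> ud ve S; rewrite ffunE => uvS.
have [A AS] : exists2 A : {set 'I_(n + n)}, A \subset S & u A * v (S :\: A) != 0.
  apply/exists_inP; apply: contraNT uvS => /exists_inPn uv0.
  rewrite big1 // => A /uv0; rewrite negbK => /eqP ->; exact: mulr0.
have [->|/ud[uA leA]] := eqVneq (u A) 0; first by rewrite mul0r eqxx.
have [->|/ve[vA leB] _] := eqVneq (v (S :\: A)) 0; first by rewrite mulr0 eqxx.
have part (f : 'I_n -> 'I_(n + n)) :
    #|[set i | f i \in S]| =
    (#|[set i | f i \in A]| + #|[set i | f i \in S :\: A]|)%N.
  rewrite -(cardsID [set i | f i \in A]).
  have -> : [set i | f i \in S] :&: [set i | f i \in A] = [set i | f i \in A].
    by apply/setP => i; rewrite !inE; apply/andb_idl/(subsetP AS).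
  by congr (_ + _)%N; apply: eq_card => i; rewrite !inE andbC.
rewrite [#|holo_part S|]part [#|anti_part S|]part.
by rewrite -!/(holo_part _) -!/(anti_part _) -uA -vA; split; rewrite // leq_add.
Qed.

Lemma diagonal_leW d e u : (d <= e)%N -> diagonal_le d u -> diagonal_le e u.
Proof. by move=> de ud S /ud[-> leS]; split => //; apply: leq_trans de. Qed.

Lemma diagonal_le_dz j k : diagonal_le 1 (dz j * dzbar k).
Proof.
move=> S; rewrite ffunE => jkS.
have [A AS] : exists2 A : {set 'I_(n + n)}, A \subset S &
    dz j A * dzbar k (S :\: A) != 0.
  apply/exists_inP; apply: contraNT jkS => /exists_inPn uv0.
  rewrite big1 // => A /uv0; rewrite negbK => /eqP ->; exact: mulr0.
rewrite !ffunE; have [A1|_] := eqVneq A; last by rewrite mul0r eqxx.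
have [A2 _|_] := eqVneq (S :\: A); last by rewrite mulr0 eqxx.
have -> : S = [set lshift n j; rshift n k].
  by rewrite -(setID S A) (setIidPr AS) A2 A1.
suff [-> ->] : holo_part [set lshift n j; rshift n k] = [set j] /\
    anti_part [set lshift n j; rshift n k] = [set k] by rewrite !cards1.
by split; apply/setP => i; rewrite !inE ?eq_lshift ?eq_rshift
  ?eq_lrshift ?eq_rlshift ?orbF.
Qed.

Lemma diagonal_le_det m (A : 'M[exterior K (n + n)]_m) :
  (forall a b, diagonal_le 1 (A a b)) -> diagonal_le m (\det A).
Proof.
move=> A1; apply: diagonal_le_sumr => s _.
have P1 : diagonal_le m (\prod_i A i (s i)).
  rewrite -[X in diagonal_le X]card_ord -sum1_card.
  elim/big_rec2 : _ => [|i d u _ ud]; first exact: diagonal_le1.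
  exact: diagonal_leM.
case: (odd_perm s); rewrite ?expr1 ?expr0 ?mulN1r ?mul1r //.
by rewrite -scaleN1r; apply: diagonal_leZ.
Qed.

End HorizontalCovectors.

From mathcomp Require Import complex.
From mathcomp Require Import all_classical all_reals all_analysis.
Import numFieldNormedType.Exports.

Local Open Scope classical_set_scope.

(* R[i]^o is the field R[i] with its topology and its norm. *)
Local Notation C R := (R[i]^o)%type.
(* Points of C^n x C^m: local coordinates (z, eta) on the total space. *)
Local Notation coords R n m := ('cV[C R]_n * 'cV[C R]_m)%type.

Section Wirtinger.
Context {R : realType} {V : normedModType R[i]}.
Implicit Types (f : V -> C R) (v p : V).

Definition real_derivable v f p :=
  derivable (fun t : R => complex.Re (f (p + t%:C%C *: v))) 0 1 /\
  derivable (fun t : R => complex.Im (f (p + t%:C%C *: v))) 0 1.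

Definition real_derive v f p : C R :=
  (derive1 (fun t : R => complex.Re (f (p + t%:C%C *: v))) 0 +i*
   derive1 (fun t : R => complex.Im (f (p + t%:C%C *: v))) 0)%C.

(* All iterated directional derivatives exist and are continuous on D. *)
Definition smooth_on (D : set V) f :=
  forall (vs : seq V) p, D p ->
    {for p, continuous (foldr real_derive f vs)} /\
    forall v, real_derivable v (foldr real_derive f vs) p.

(* In the direction of a coordinate vector v of C^N these are the usual
   (d/dx - i d/dy)/2 and (d/dx + i d/dy)/2. *)
Definition wirtinger v f p : C R :=
  2^-1 * (real_derive v f p - 'i%C * real_derive ('i%C *: v) f p).

Definition wirtinger_bar v f p : C R :=
  2^-1 * (real_derive v f p + 'i%C * real_derive ('i%C *: v) f p).

End Wirtinger.

Definition holomorphic_on {R : realType} {V W : normedModType R[i]}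
    (D : set V) (f : V -> W) :=
  forall p, D p -> differentiable f p.

Definition homeomorphic_on {X Y : topologicalType} (A : set X) (B : set Y)
    (f : X -> Y) (g : Y -> X) :=
  [/\ f @` A = B, (forall x, A x -> g (f x) = x),
      {within A, continuous f} & {within B, continuous g}].

(* A holomorphic vector bundle of rank m over an n-dimensional complex
   manifold, given by an atlas whose charts (z^k, eta^a) consist of holomorphic
   coordinates on an open subset of the base and a holomorphic frame over it.
   The linear structure of the fibres is the one read in the coordinates
   eta. *)
Record holomorphicVectorBundle (R : realType) (n m : nat) := {
  bundle_base : topologicalType ;
  bundle_total : topologicalType ;
  bundle_proj : bundle_total -> bundle_base ;
  chart : Type ;
  chart_dom : chart -> set bundle_base ;
  zcoord : chart -> bundle_base -> 'cV[C R]_n ;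
  zcoord_inv : chart -> 'cV[C R]_n -> bundle_base ;
  etacoord : chart -> bundle_total -> 'cV[C R]_m ;
  point_at : chart -> coords R n m -> bundle_total ;
  base_hausdorff : hausdorff_space bundle_base ;
  base_second_countable : @second_countable bundle_base ;
  proj_continuous : continuous bundle_proj ;
  dom_open : forall c, open (chart_dom c) ;
  dom_cover : forall x, exists c, chart_dom c x ;
  zcoord_open : forall c, open (zcoord c @` chart_dom c) ;
  zcoord_homeo : forall c,
    homeomorphic_on (chart_dom c) (zcoord c @` chart_dom c) (zcoord c) (zcoord_inv c) ;
  bundle_homeo : forall c,
    homeomorphic_on (bundle_proj @^-1` chart_dom c) ((zcoord c @` chart_dom c) `*` setT)
      (fun e => (zcoord c (bundle_proj e), etacoord c e)) (point_at c) ;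
  base_transition : forall c d,
    holomorphic_on (zcoord c @` (chart_dom c `&` chart_dom d))
      (zcoord d \o zcoord_inv c) ;
  frame_transition : forall c d, exists M : 'cV[C R]_n -> 'M[C R]_m,
    holomorphic_on (zcoord c @` (chart_dom c `&` chart_dom d)) M /\
    forall e, chart_dom c (bundle_proj e) -> chart_dom d (bundle_proj e) ->
      M (zcoord c (bundle_proj e)) \in unitmx /\
      etacoord d e = M (zcoord c (bundle_proj e)) *m etacoord c e
}.

(* The range, in the coordinates of the chart c, of the points off the zero
   section. *)
Definition Estar {R n m} (E : holomorphicVectorBundle R n m) (c : chart E) :
    set (coords R n m) :=
  [set p | (zcoord c @` chart_dom c) p.1 /\ p.2 != 0].

(* Calculus in the coordinates (z, eta), for the local expression
   G = F^2 : C^n x C^m -> C of a squared complex Finsler metric. *)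
Section LocalCalculus.
Context {R : realType} {n m : nat}.
Implicit Types (f G : coords R n m -> C R) (p : coords R n m).
Implicit Types (j k : 'I_n) (a b c : 'I_m).

Definition e_z k : coords R n m := (delta_mx k 0, 0).
Definition e_eta a : coords R n m := (0, delta_mx a 0).

Definition d_z k f := wirtinger (e_z k) f.
Definition d_zbar k f := wirtinger_bar (e_z k) f.
Definition d_eta a f := wirtinger (e_eta a) f.
Definition d_etabar a f := wirtinger_bar (e_eta a) f.

Definition levi G p : 'M[C R]_m :=
  \matrix_(a, b) d_eta a (d_etabar b G) p.

(* h^{cbar a} is the entry (c, a) of the inverse of (h_{a cbar})_{a, c}. *)
Definition chern_finsler G a k p : C R :=
  \sum_c invmx (levi G p) c a * d_z k (d_etabar c G) p.

(* Vector fields of type (1, 0), by their components along the d/dz^k and the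
   d/deta^a. *)
Definition vfield10 := coords R n m -> coords R n m.
Implicit Types X Y : vfield10.

Definition vf_apply X f p : C R :=
  \sum_k (X p).1 k 0 * d_z k f p + \sum_a (X p).2 a 0 * d_eta a f p.

(* The action of the conjugate field, of type (0, 1). *)
Definition vf_conj_apply X f p : C R :=
  \sum_k conjc ((X p).1 k 0) * d_zbar k f p +
  \sum_a conjc ((X p).2 a 0) * d_etabar a f p.

Definition lie_bracket X Y : vfield10 := fun p =>
  (\col_k (vf_apply X (fun q => (Y q).1 k 0) p -
           vf_apply Y (fun q => (X q).1 k 0) p),
   \col_a (vf_apply X (fun q => (Y q).2 a 0) p -
           vf_apply Y (fun q => (X q).2 a 0) p)).

Definition horizontal_field G k : vfield10 := fun p =>
  (delta_mx k 0, - \col_a chern_finsler G a k p).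

Definition vertical_field b : vfield10 := fun=> e_eta b.

(* v' along the horizontal bundle; as d/dz^k = delta_k + N^a_k d/deta^a, the
   eta^a-component of v' X is X^a + N^a_k X^k. *)
Definition vertical_proj G X : vfield10 := fun p =>
  (0, \col_a ((X p).2 a 0 + \sum_k chern_finsler G a k p * (X p).1 k 0)).

Definition bott G X Y : vfield10 := vertical_proj G (lie_bracket X Y).

(* L^a_{bk}: the component along d/deta^a of the Bott derivative of d/deta^b
   in the direction of delta_k. *)
Definition bott_coef G a b k p : C R :=
  (bott G (horizontal_field G k) (vertical_field b) p).2 a 0.

Definition delta_bar G k f p : C R :=
  vf_conj_apply (horizontal_field G k) f p.

Definition curvature_coef G a b j k p : C R :=
  - delta_bar G k (bott_coef G a b j) p.

Definition curvature G a b p : exterior (C R) (n + n) :=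
  \sum_j \sum_k curvature_coef G a b j k p *: (dz j * dzbar k).

Definition chern_det G p : exterior (C R) (n + n) :=
  \det (1%:M -
        \matrix_(a, b) (((2 * pi)%:C%C * 'i%C : C R)^-1 *: curvature G a b p)).

Definition chern_form G (j : nat) p : exterior (C R) (n + n) :=
  type_component j j (chern_det G p).

(* phi_{I Jbar} is the coefficient with I and J increasing; p = #|I| and the
   position of k in J is #|{l in J | l < k}|. *)
Definition dbar_h G (phi : coords R n m -> exterior (C R) (n + n)) p :
    exterior (C R) (n + n) :=
  [ffun S : {set 'I_(n + n)} =>
     (-1) ^+ #|holo_part S| *
     \sum_(k in anti_part S)
       (-1) ^+ #|[set l in anti_part S | (l < k)%N]%SET| *
       delta_bar G k (fun q => phi q (S :\ rshift n k)%SET) p].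

End LocalCalculus.

Section LocalCalculusLemmas.
Context {R : realType} {n m : nat}.
Implicit Types (f G : coords R n m -> C R) (p v : coords R n m).

Lemma derive1N_total (g : R -> R) t : derive1 (\- g) t = - derive1 g t.
Proof.
rewrite !derive1E; have [dg|ndg] := pselect (derivable g t 1).
  exact: deriveN.
have ndNg : ~ derivable (\- g) t 1.
  by move=> /derivableN; rewrite (_ : - (\- g) = g) //; apply/funext => x;
    exact: opprK.
have D0 h : ~ derivable h t 1 -> 'D_1 h t = 0 :> R by exact: dvgP.
by rewrite !D0 // oppr0.
Qed.

Lemma real_derive_cst v (x : C R) p : real_derive v (fun=> x) p = 0.
Proof. by rewrite /real_derive !derive1_cst. Qed.

Lemma real_deriveN v f p :
  real_derive v (fun q => - f q) p = - real_derive v f p.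
Proof.
have ReN (z : C R) : complex.Re (- z) = - complex.Re z by case: z.
have ImN (z : C R) : complex.Im (- z) = - complex.Im z by case: z.
have NE (x y : R) : - (x +i* y)%C = (- x +i* - y)%C :> C R by [].
rewrite /real_derive NE -!derive1N_total; congr (_ +i* _)%C;
  by congr (derive1 _ _); apply/funext => t; rewrite (ReN, ImN).
Qed.

Lemma vf_apply_cst X (x : C R) p : vf_apply X (fun=> x) p = 0.
Proof.
rewrite /vf_apply !big1 ?addr0 // => i _;
  by rewrite /d_z /d_eta /wirtinger !real_derive_cst mulr0 subrr !mulr0.
Qed.

Lemma bott_coefE G a b k p :
  bott_coef G a b k p = d_eta b (chern_finsler G a k) p.
Proof.
rewrite /bott_coef /bott /= !mxE big1 => [|l _]; last first.
  by rewrite !mxE /= !vf_apply_cst subrr mulr0.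
rewrite vf_apply_cst sub0r addr0 /vf_apply big1 ?add0r => [|l _]; last first.
  by rewrite mxE mul0r.
rewrite (bigD1 b) //= !mxE !eqxx mul1r big1 ?addr0 => [|l lb]; last first.
  by rewrite mxE (negPf lb) mul0r.
rewrite (_ : (fun q => _) = fun q => - chern_finsler G a k q); last first.
  by apply/funext => q; rewrite !mxE.
by rewrite /d_eta /wirtinger !real_deriveN !mulrN -opprD mulrN opprK.
Qed.

Lemma delta_barE G k f p :
  delta_bar G k f p =
  d_zbar k f p - \sum_a conjc (chern_finsler G a k p) * d_etabar a f p.
Proof.
rewrite /delta_bar /vf_conj_apply /= (bigD1 k) //= mxE !eqxx conjc1 mul1r.
rewrite big1 ?addr0 => [|l lk]; last by rewrite mxE (negPf lk) conjc0 mul0r.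
congr (_ + _); rewrite -sumrN; apply: eq_bigr => a _.
by rewrite !mxE rmorphN mulNr.
Qed.

Lemma chern_formE G p : chern_det G p = \sum_(j < m.+1) chern_form G j p.
Proof.
apply/diagonal_le_sum/diagonal_le_det => a b; rewrite !mxE.
apply: diagonal_leD.
  by case: (a == b) => S; [move=> /diagonal_le1[-> le0]; split;
    rewrite ?(leq_trans le0) | rewrite ffunE eqxx].
rewrite -scaleN1r; apply/diagonal_leZ/diagonal_leZ.
do 2![apply: diagonal_le_sumr => ? _].
exact/diagonal_leZ/diagonal_le_dz.
Qed.

Lemma chern_form_type G j p : has_type j j (chern_form G j p).
Proof. exact: type_component_type. Qed.

End LocalCalculusLemmas.

(* The local expression of F^2 in the chart c. *)
Definition squared_local {R n m} (E : holomorphicVectorBundle R n m)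
    (F : bundle_total E -> R) (c : chart E) (p : coords R n m) : C R :=
  ((F (point_at c p)) ^+ 2)%:C%C.

Record complexFinslerBundle (R : realType) (n m : nat) := {
  finsler_bundle :> holomorphicVectorBundle R n m ;
  finsler : bundle_total finsler_bundle -> R ;
  finsler_ge0 : forall e, 0 <= finsler e ;
  finsler_smooth : forall c,
    smooth_on (Estar c) (squared_local finsler c) ;
  finsler_eq0 : forall c e, chart_dom c (bundle_proj e) ->
    (finsler e = 0 <-> etacoord c e = 0) ;
  finsler_homogeneous : forall c z eta (lambda : C R),
    (zcoord c @` chart_dom c) z -> lambda != 0 ->
    (finsler (point_at c (z, lambda *: eta)))%:C%C =
    `|lambda| * (finsler (point_at c (z, eta)))%:C%C ;
  (* positive definiteness of (h_{a bbar}), hermitian symmetry included *)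
  finsler_posdef : forall c p, Estar c p ->
    forall xi : 'cV[C R]_m, xi != 0 ->
      0 < \sum_a \sum_b
            levi (squared_local finsler c) p a b * xi a 0 * conjc (xi b 0)
}.

(* A horizontal form on E^*, by its local expressions in the charts; only the
   values on Estar c are meaningful. *)
Definition horizontal_form {R n m} (E : holomorphicVectorBundle R n m) :=
  chart E -> coords R n m -> exterior (C R) (n + n).

Definition chern_hform {R n m} (E : complexFinslerBundle R n m) (j : nat) :
    horizontal_form E :=
  fun c => chern_form (squared_local (@finsler R n m E) c) j.
Arguments chern_hform {R n m} E j c p.

Definition dbar_hform {R n m} (E : complexFinslerBundle R n m)
    (phi : horizontal_form E) : horizontal_form E :=
  fun c => dbar_h (squared_local (@finsler R n m E) c) (phi c).
Arguments dbar_hform {R n m} E phi c p.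

(* Main.v *)
(* The conjugate adapted fields delta_kbar commute: [delta_j, delta_k] is vertical
   with the bracket of the connection coefficients as components, and every
   delta_k annihilates the functions dF^2/detabar^c, whose vertical derivatives
   form the invertible Levi matrix. Hence d''h = \sum_k dzbar^k /\ delta_kbar is
   a derivation of square zero. The curvature is d''h of the connection form, so
   its entries are closed; being of even degree they generate an algebra of
   closed forms, which contains the determinant. Finally d''h maps type (p, q)
   to type (p, q + 1), so each component of the determinant is closed. *)
Require Import Defs.
From mathcomp Require Import all_boot all_order all_fingroup all_algebra.
From mathcomp Require Import complex ring lra.
From mathcomp Require Import all_classical all_reals all_analysis.

Set Implicit Arguments.
Unset Strict Implicit.
Unset Printing Implicit Defensive.

Import Order.TTheory GRing.Theory Num.Theory.
Import numFieldNormedType.Exports.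

Local Open Scope classical_set_scope.
Local Open Scope ring_scope.

Local Notation C R := (R[i]^o)%type.
Local Notation coords R n m := ('cV[C R]_n * 'cV[C R]_m)%type.

(** The ring [exterior] is not commutative, so [\det] stands for the signed sum over permutations of
    products taken in row order. That sum can still be handled factor by factor: closedness passes
    to any product of forms that commute with every [dzbar k], whether or not the factors commute
    with each other. The analytic work comes from [smooth_on], which offers only continuous iterated
    derivatives along real lines. The rules for products and inverses, needed for the inverse Levi
    matrix inside the Chern-Finsler coefficients, and the symmetry of second derivatives are drawn
    from one-variable calculus of real and imaginary parts. Local expressions are total functions
    that mean something only on an open set [D], so every operator must respect equality on [D].
    Flatness of the coefficients is proved for the unconjugated fields, since those are the ones for
    which the coefficients solve a linear system with the Levi matrix; conjugation then carries it
    over. *)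

(** * Directional derivatives and C^k functions *)

Section CkCalculus.
Context {R : realType} {V : normedModType R[i]}.
Implicit Types (f g : V -> C R) (v w p : V) (D : set V).

Lemma Re_add (a b : C R) : complex.Re (a + b) = complex.Re a + complex.Re b.
Proof. by case: a b => ? ? []. Qed.

Lemma Im_add (a b : C R) : complex.Im (a + b) = complex.Im a + complex.Im b.
Proof. by case: a b => ? ? []. Qed.

Lemma Re_mul (a b : C R) :
  complex.Re (a * b) = complex.Re a * complex.Re b - complex.Im a * complex.Im b.
Proof. by case: a b => ? ? []. Qed.

Lemma Im_mul (a b : C R) :
  complex.Im (a * b) = complex.Re a * complex.Im b + complex.Im a * complex.Re b.
Proof. by case: a b => ? ? []. Qed.

(** Existence and value are kept together, as in [is_derive]: [real_derive] alone is a total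
    function and does not record existence. *)
Definition has_real_derive v f p (z : C R) :=
  is_derive (0 : R) (1 : R) (fun t : R => complex.Re (f (p + t%:C%C *: v)))
    (complex.Re z) /\
  is_derive (0 : R) (1 : R) (fun t : R => complex.Im (f (p + t%:C%C *: v)))
    (complex.Im z).

Lemma real_derivableP v f p :
  real_derivable v f p -> has_real_derive v f p (real_derive v f p).
Proof.
move=> [dRe dIm]; split; rewrite /= derive1E; exact: derivableP.
Qed.

Lemma has_real_derive_ex v f p z : has_real_derive v f p z -> real_derivable v f p.
Proof. by move=> [dRe dIm]; split; exact: ex_derive. Qed.

Lemma has_real_derive_val v f p z : has_real_derive v f p z -> real_derive v f p = z.
Proof.
by case: z => x y [/= dRe dIm]; rewrite /real_derive !derive1E !derive_val.
Qed.

Lemma has_real_derive_cst v p (z : C R) : has_real_derive v (fun=> z) p 0.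
Proof. by split; exact: is_derive_cst. Qed.

Lemma has_real_deriveD v f g p x y :
  has_real_derive v f p x -> has_real_derive v g p y ->
  has_real_derive v (fun q => f q + g q) p (x + y).
Proof.
move=> [fR fI] [gR gI]; split.
  under eq_fun do rewrite Re_add.
  by rewrite Re_add; exact: is_deriveD.
under eq_fun do rewrite Im_add.
by rewrite Im_add; exact: is_deriveD.
Qed.

Lemma has_real_deriveM v f g p x y :
  has_real_derive v f p x -> has_real_derive v g p y ->
  has_real_derive v (fun q => f q * g q) p (x * g p + f p * y).
Proof.
move=> [fR fI] [gR gI]; split.
  under eq_fun do rewrite Re_mul.
  apply: is_derive_eq (is_deriveB (is_deriveM fR gR) (is_deriveM fI gI)) _.
  rewrite Re_add !Re_mul !scale0r !addr0 /GRing.scale /=; ring.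
under eq_fun do rewrite Im_mul.
apply: is_derive_eq (is_deriveD (is_deriveM fR gI) (is_deriveM fI gR)) _.
rewrite Im_add !Im_mul !scale0r !addr0 /GRing.scale /=; ring.
Qed.

Lemma conjE (z : C R) : conjc z = (complex.Re z -i* complex.Im z)%C.
Proof. by case: z. Qed.

Lemma has_real_derive_conj v f p x :
  has_real_derive v f p x -> has_real_derive v (fun q => conjc (f q)) p (conjc x).
Proof.
move=> [fR fI]; split; rewrite conjE /=.
  by under eq_fun do rewrite conjE /=.
under eq_fun do rewrite conjE /=.
exact: is_deriveN.
Qed.

(** No derivability is assumed: by [derive1N_total] the sign passes through the default value too.
    Conjugation can therefore be moved through derivatives as an identity of functions. *)
Lemma real_derive_conj v f p :
  real_derive v (fun q => conjc (f q)) p = conjc (real_derive v f p).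
Proof.
rewrite /real_derive /= -derive1N_total; congr (_ +i* _)%C.
  by congr (derive1 _ _); apply/funext => t; rewrite conjE.
by congr (derive1 _ _); apply/funext => t; rewrite conjE.
Qed.

(** Writing the inverse as the conjugate over the squared modulus leaves only the real quotient rule
    along the line through [p]. *)
Lemma has_real_deriveV v f p x : f p != 0 ->
  has_real_derive v f p x ->
  has_real_derive v (fun q => (f q)^-1) p (- (x * (f p)^-1 ^+ 2)).
Proof.
have ReV (a : C R) :
  complex.Re (a^-1) = complex.Re a / (complex.Re a ^+ 2 + complex.Im a ^+ 2).
  by case: a.
have ImV (a : C R) :
  complex.Im (a^-1) = - (complex.Im a / (complex.Re a ^+ 2 + complex.Im a ^+ 2)).
  by case: a.
move=> f0 [fR fI].
pose r t := complex.Re (f (p + t%:C%C *: v)).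
pose i t := complex.Im (f (p + t%:C%C *: v)).
have n0 : (r * r + i * i) 0 != 0.
  rewrite /r /i /= !fctE scale0r addr0 -!expr2.
  rewrite paddr_eq0 ?sqr_ge0 // !sqrf_eq0.
  by case: (f p) f0 => a b; rewrite eq_complex.
have dn := is_deriveD (is_deriveM fR fR) (is_deriveM fI fI).
have dV := DeriveDef (derivableV n0 (@ex_derive _ _ _ _ _ _ _ dn)) erefl.
rewrite deriveV // (@derive_val _ _ _ _ _ _ _ dn) in dV.
split.
  under eq_fun do rewrite ReV.
  apply: is_derive_eq (is_deriveM fR dV) _.
  rewrite /= !fctE /= /r /i /= in n0 *.
  rewrite !scale0r !addr0 in n0 *; rewrite /GRing.scale /=.
  case: x {fR fI dn dV} => c d; case: (f p) n0 => a b /= n0.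
  have {}n0 : a ^+ 2 + b ^+ 2 != 0 by rewrite !expr2.
  field; exact: n0.
under eq_fun do rewrite ImV.
apply: is_derive_eq (is_deriveN (is_deriveM fI dV)) _.
rewrite /= !fctE /= /r /i /= in n0 *.
rewrite !scale0r !addr0 in n0 *; rewrite /GRing.scale /=.
case: x {fR fI dn dV} => c d; case: (f p) n0 => a b /= n0.
have {}n0 : a ^+ 2 + b ^+ 2 != 0 by rewrite !expr2.
field; exact: n0.
Qed.

Lemma continuousD_at f g p : {for p, continuous f} -> {for p, continuous g} ->
  {for p, continuous (fun q => f q + g q)}.
Proof. exact: (@cvgD _ _ _ _ _ f g). Qed.
Lemma continuousM_at f g p : {for p, continuous f} -> {for p, continuous g} ->
  {for p, continuous (fun q => f q * g q)}.
Proof. exact: (@cvgM _ _ _ _ f g). Qed.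
Lemma continuousV_at f p : f p != 0 -> {for p, continuous f} ->
  {for p, continuous (fun q => (f q)^-1)}.
Proof. exact: (@cvgV _ _ _ _ f). Qed.
Lemma continuous_conj_at f p : {for p, continuous f} ->
  {for p, continuous (fun q => conjc (f q) : C R)}.
Proof.
move=> fp; apply/cvgrPdist_lt => e e0; move/cvgrPdist_lt : fp => /(_ e e0).
apply: filterS => q; by rewrite -rmorphB normcJ.
Qed.

(** Bridges norms with values in [R[i]] and lines with real parameters. The plane spanned by [v] and
    [w] serves the symmetry of second derivatives; [w = 0] gives single lines. *)
Lemma line_near p v w (A : set V) : nbhs p A ->
  exists2 d : R, 0 < d & forall s t : R, `|s| < d -> `|t| < d ->
    A (p + s%:C%C *: v + t%:C%C *: w).
Proof.
move=> /nbhs_ballP[e /= e0 eA].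
have nrm (x : V) : `|x| = (complex.Re `|x|)%:C%C.
  by rewrite RRe_real // normr_real.
have eE : e = (complex.Re e)%:C%C by rewrite RRe_real // gtr0_real.
pose N := 1 + complex.Re `|v| + complex.Re `|w|.
have v0 : 0 <= complex.Re `|v| by rewrite -ler0c -nrm.
have w0 : 0 <= complex.Re `|w| by rewrite -ler0c -nrm.
have N0 : 0 < N by rewrite /N; lra.
have re0 : 0 < complex.Re e by rewrite -ltcR -eE.
exists (complex.Re e / N); first exact: divr_gt0.
move=> s t sd td; apply: eA.
rewrite -ball_normE /ball_ /= -addrA opprD addNKr normrN.
apply: le_lt_trans (ler_normD _ _) _.
rewrite !normrZ eE (nrm v) (nrm w) !normc_def /= expr0n /= !addr0 !sqrtr_sqr.
rewrite -!rmorphM -rmorphD ltcR.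
move: sd td; rewrite !ltr_pdivlMr // /N => sd td.
have := normr_ge0 s; have := normr_ge0 t.
by nra.
Qed.

Lemma near_real_derive v f g p : (\forall q \near p, f q = g q) ->
  real_derive v f p = real_derive v g p /\
  (real_derivable v f p -> real_derivable v g p).
Proof.
move=> /(line_near v 0)[d d0 fg].
have H : \forall t \near (0 : R), f (p + t%:C%C *: v) = g (p + t%:C%C *: v).
  exists d => //= t /=; rewrite sub0r normrN => td.
  by have := fg t 0 td; rewrite normr0 scale0r addr0; apply.
have HR : \forall t \near (0 : R),
    complex.Re (f (p + t%:C%C *: v)) = complex.Re (g (p + t%:C%C *: v)).
  by apply: filterS H => t ->.
have HI : \forall t \near (0 : R),
    complex.Im (f (p + t%:C%C *: v)) = complex.Im (g (p + t%:C%C *: v)).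
  by apply: filterS H => t ->.
split.
  rewrite /real_derive !derive1E; congr (_ +i* _)%C; exact: near_eq_derive.
move=> [dR dI]; split; [move: dR|move: dI]; exact: near_eq_derivable.
Qed.

(** A finite order permits induction: a derivative of a product or an inverse is built from
    functions of one order less. Order 0 already asks for all first directional derivatives, though
    not for their continuity. *)
Fixpoint Ck k D f : Prop :=
  (forall p, D p -> {for p, continuous f} /\ forall v, real_derivable v f p) /\
  if k is k'.+1 then forall v, Ck k' D (real_derive v f) else True.

(** In the [foldr] of [smooth_on] the last direction acts first, whereas [Ck] strips the innermost
    derivative; hence lists are taken apart from their right end. *)
Lemma Ck_smooth D f : smooth_on D f <-> forall k, Ck k D f.
Proof.
split.
  move=> fs k; elim: k f fs => [|k IH] f fs /=; split=> //.
  - by move=> p Dp; exact: (fs [::] p Dp).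
  - by move=> p Dp; exact: (fs [::] p Dp).
  - move=> v; apply: IH => vs p Dp; have := fs (rcons vs v) p Dp.
    by rewrite foldr_rcons.
move=> fk vs; elim/last_ind: vs f fk => [|vs v IH] f fk p Dp.
  by have [/(_ p Dp)] := fk 0%N.
rewrite foldr_rcons; apply: IH => // k; have [_] := fk k.+1; exact.
Qed.

Lemma CkW k D f : Ck k.+1 D f -> Ck k D f.
Proof.
elim: k f => [|k IH] f /=; first by move=> [fD _]; split.
by move=> [fD fv]; split => // v; apply: IH; apply: fv.
Qed.

Lemma Ck0 k D f : Ck k D f -> Ck 0 D f.
Proof. by elim: k f => // k IH f /CkW; exact: IH. Qed.

Lemma Ck_derivable k D f v p : Ck k D f -> D p -> real_derivable v f p.
Proof. by move=> /Ck0[fD _] /fD[]. Qed.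

Lemma Ck_continuous k D f p : Ck k D f -> D p -> {for p, continuous f}.
Proof. by move=> /Ck0[fD _] /fD[]. Qed.

(** On an open set, equality on [D] is equality near each of its points and so survives
    differentiation. The Leibniz formulas hold only on [D], and this is how they enter the
    inductions below. *)
Lemma Ck_ext k D f g : open D -> (forall p, D p -> f p = g p) -> Ck k D f -> Ck k D g.
Proof.
move=> oD.
have near_eq f' g' p : (forall q, D q -> f' q = g' q) -> D p ->
    \forall q \near p, f' q = g' q.
  by move=> fg Dp; apply: filterS (open_nbhs_nbhs (conj oD Dp)) => q /fg.
have C0 f' g' : (forall q, D q -> f' q = g' q) ->
    (forall p, D p -> {for p, continuous f'} /\ forall v, real_derivable v f' p) ->
    forall p, D p -> {for p, continuous g'} /\ forall v, real_derivable v g' p.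
  move=> fg fD p Dp; have [fc fd] := fD p Dp; split.
    change (g' @ p --> g' p); rewrite -(fg p Dp); apply: cvg_trans fc.
    exact: near_eq_cvg (near_eq _ _ _ fg Dp).
  by move=> v; apply: (near_real_derive v (near_eq _ _ _ fg Dp)).2.
elim: k f g => [|k IH] f g fg [fD fv]; first exact: (conj (C0 f g fg fD) I).
split; first exact: (C0 f g fg fD).
move=> v; apply: IH (fv v) => p Dp.
exact: (near_real_derive v (near_eq _ _ _ fg Dp)).1.
Qed.

Lemma real_deriveD k D f g v p : Ck k D f -> Ck k D g -> D p ->
  real_derive v (fun q => f q + g q) p = real_derive v f p + real_derive v g p.
Proof.
move=> fk gk Dp; apply: has_real_derive_val; apply: has_real_deriveD;
  apply: real_derivableP; [exact: Ck_derivable fk Dp|exact: Ck_derivable gk Dp].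
Qed.

Lemma real_deriveM k D f g v p : Ck k D f -> Ck k D g -> D p ->
  real_derive v (fun q => f q * g q) p =
    real_derive v f p * g p + f p * real_derive v g p.
Proof.
move=> fk gk Dp; apply: has_real_derive_val; apply: has_real_deriveM;
  apply: real_derivableP; [exact: Ck_derivable fk Dp|exact: Ck_derivable gk Dp].
Qed.

Lemma real_deriveV k D f v p : Ck k D f -> D p -> f p != 0 ->
  real_derive v (fun q => (f q)^-1) p = - (real_derive v f p * (f p)^-1 ^+ 2).
Proof.
move=> fk Dp f0; apply: has_real_derive_val; apply: (has_real_deriveV f0).
by apply: real_derivableP; exact: Ck_derivable fk Dp.
Qed.

Lemma Ck_cst k D (x : C R) : Ck k D (fun=> x).
Proof.
elim: k x => [|k IH] x; split => //.
1,2: move=> p _; split; [exact: cvg_cst|].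
1,2: move=> v; apply: has_real_derive_ex; exact: has_real_derive_cst.
move=> v; rewrite (_ : real_derive v _ = fun=> 0); first exact: IH.
by apply/funext => p; exact: has_real_derive_val (has_real_derive_cst _ _ _).
Qed.

Lemma CkD k D f g : open D -> Ck k D f -> Ck k D g -> Ck k D (fun q => f q + g q).
Proof.
move=> oD; elim: k f g => [|k IH] f g fk gk.
all: split => //.
1,2: move=> p Dp; split; [apply: continuousD_at;
    [exact: Ck_continuous fk Dp|exact: Ck_continuous gk Dp]|].
1,2: move=> v; apply: has_real_derive_ex; apply: has_real_deriveD;
  apply: real_derivableP; [exact: Ck_derivable fk Dp|exact: Ck_derivable gk Dp].
move=> v; apply: (Ck_ext oD (fun p Dp => esym (real_deriveD v fk gk Dp))).
by apply: IH; [case: fk => _; apply|case: gk => _; apply].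
Qed.

Lemma CkM k D f g : open D -> Ck k D f -> Ck k D g -> Ck k D (fun q => f q * g q).
Proof.
move=> oD; elim: k f g => [|k IH] f g fk gk.
all: split => //.
1,2: move=> p Dp; split; [apply: continuousM_at;
    [exact: Ck_continuous fk Dp|exact: Ck_continuous gk Dp]|].
1,2: move=> v; apply: has_real_derive_ex; apply: has_real_deriveM;
  apply: real_derivableP; [exact: Ck_derivable fk Dp|exact: Ck_derivable gk Dp].
move=> v; apply: (Ck_ext oD (fun p Dp => esym (real_deriveM v fk gk Dp))).
apply: (CkD oD).
  apply: IH; last exact: CkW.
  by case: fk => _; apply.
apply: IH; first exact: CkW.
by case: gk => _; apply.
Qed.

(** The derivative of the inverse is a product of the derivative of [f] and the inverse itself, so
    the induction hypothesis applies to that same inverse at one order less. *)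
Lemma CkV k D f : open D -> (forall p, D p -> f p != 0) ->
  Ck k D f -> Ck k D (fun q => (f q)^-1).
Proof.
move=> oD f0; elim: k f f0 => [|k IH] f f0 fk.
all: split => //.
1,2: move=> p Dp; split; [apply: continuousV_at;
    [exact: f0|exact: Ck_continuous fk Dp]|].
1,2: move=> v; apply: has_real_derive_ex; apply: has_real_deriveV;
  [exact: f0|apply: real_derivableP; exact: Ck_derivable fk Dp].
move=> v; apply: (Ck_ext oD (fun p Dp => esym (real_deriveV v fk Dp (f0 p Dp)))).
have Vk : Ck k D (fun q => (f q)^-1) by apply: IH => //; exact: CkW.
have N1 := @Ck_cst k D (-1).
have fvk : Ck k D (real_derive v f) by case: fk => _; apply.
apply: (Ck_ext oD _ (CkM oD (CkM oD N1 fvk) (CkM oD Vk Vk))) => p Dp.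
by rewrite /= mulN1r mulNr expr2.
Qed.

Lemma Ck_conj k D f : Ck k D f -> Ck k D (fun q => conjc (f q)).
Proof.
elim: k f => [|k IH] f fk.
all: split => //.
1,2: move=> p Dp; split; [apply: continuous_conj_at; exact: Ck_continuous fk Dp|].
1,2: move=> v; apply: has_real_derive_ex; apply: has_real_derive_conj;
   apply: real_derivableP; exact: Ck_derivable fk Dp.
move=> v; rewrite (_ : real_derive v _ = fun p => conjc (real_derive v f p)).
  by apply: IH; case: fk => _; apply.
by apply/funext => p; exact: real_derive_conj.
Qed.

End CkCalculus.

(** * Symmetry of second derivatives *)

(** The mean value theorem is used twice: on the difference of [g] across the second variable, then
    on [g1 s]. *)
Lemma mixed_MVT (R : realType) (g g1 g12 : R -> R -> R) (d h : R) :
  0 < h -> h < d ->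
  (forall s t : R, `|s| < d -> `|t| < d -> is_derive s (1 : R) (g^~ t) (g1 s t)) ->
  (forall s t : R, `|s| < d -> `|t| < d -> is_derive t (1 : R) (g1 s) (g12 s t)) ->
  exists s t, [/\ `|s| < h, `|t| < h &
    g h h - g h 0 - (g 0 h - g 0 0) = g12 s t * h * h].
Proof.
move=> h0 hd Dg Dg1.
have in_d (x : R) : x \in `[0, h]%R -> `|x| < d.
  by rewrite in_itv /= => /andP[x0 xh]; rewrite ger0_norm // (le_lt_trans xh).
have hd' : `|h| < d by rewrite gtr0_norm.
have d0 : `|0 : R| < d by rewrite normr0 (lt_trans h0).
pose G s := g s h - g s 0.
have DG (s : R) : `|s| < d -> is_derive s (1 : R) G (g1 s h - g1 s 0).
  by move=> sd; exact: is_deriveB (Dg s h sd hd') (Dg s 0 sd d0).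
have [||s sI Gs] := @MVT _ G (fun s => g1 s h - g1 s 0) 0 h h0.
- by move=> s sI; apply/DG/in_d/subset_itv_oo_cc.
- apply: derivable_within_continuous => s /in_d /DG dG; exact: ex_derive.
have sd := in_d _ (subset_itv_oo_cc sI).
have [||t tI Gt] := @MVT _ (g1 s) (g12 s) 0 h h0.
- by move=> t tI; apply/Dg1/in_d/subset_itv_oo_cc.
- apply: derivable_within_continuous => t /in_d /(Dg1 _ _ sd) dG; exact: ex_derive.
have in_h (x : R) : x \in `]0, h[%R -> `|x| < h.
  by rewrite in_itv /= => /andP[x0 xh]; rewrite gtr0_norm.
exists s, t; split; [exact: in_h|exact: in_h|].
by move: Gs; rewrite /G !subr0 Gt subr0 => <-.
Qed.

Lemma mixed_partials (R : realType) (g g1 g2 g12 g21 : R -> R -> R) (d : R) :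
  0 < d ->
  (forall s t : R, `|s| < d -> `|t| < d -> is_derive s (1 : R) (g^~ t) (g1 s t)) ->
  (forall s t : R, `|s| < d -> `|t| < d -> is_derive t (1 : R) (g1 s) (g12 s t)) ->
  (forall s t : R, `|s| < d -> `|t| < d -> is_derive t (1 : R) (g s) (g2 s t)) ->
  (forall s t : R, `|s| < d -> `|t| < d -> is_derive s (1 : R) (g2^~ t) (g21 s t)) ->
  (forall e, 0 < e -> exists2 r : R, 0 < r & forall s t, `|s| < r -> `|t| < r ->
     `|g12 s t - g12 0 0| < e /\ `|g21 s t - g21 0 0| < e) ->
  g12 0 0 = g21 0 0.
Proof.
move=> d0 D1 D12 D2 D21 cont; apply/eqP; rewrite -subr_eq0.
apply/negP => /negP ne0.
(* Half the supposed gap, so that the two approximation errors together stay below the gap. *)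
have {cont} [r r0 gr] := cont (`|g12 0 0 - g21 0 0| / 2)
  (divr_gt0 (etrans (normr_gt0 _) ne0) (ltr0n _ 2)).
pose h := Num.min r d / 2.
have m0 : 0 < Num.min r d by rewrite lt_min r0 d0.
have hm : h < Num.min r d by rewrite /h; lra.
have h0 : 0 < h by rewrite /h; lra.
move: hm; rewrite lt_min => /andP[hr hd].
have [s [t [sh th E]]] := mixed_MVT h0 hd D1 D12.
(* The second difference over the square is symmetric in the two variables, so exchanging them
   expresses the same number through [g21]. *)
have [t' [s' [th' sh' E']]] := mixed_MVT (g := fun t s => g s t)
  (g1 := fun t s => g2 s t) (g12 := fun t s => g21 s t) h0 hd
  (fun t s td sd => D2 s t sd td) (fun t s td sd => D21 s t sd td).
have EE : g12 s t = g21 s' t'.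
  apply: (mulIf (lt0r_neq0 h0)); apply: (mulIf (lt0r_neq0 h0)).
  by rewrite -E -E'; ring.
have [a _] := gr s t (lt_trans sh hr) (lt_trans th hr).
have [_ b] := gr s' t' (lt_trans sh' hr) (lt_trans th' hr).
move: a b; rewrite EE; set x := g21 s' t' => a b.
have : `|g12 0 0 - g21 0 0| <= `|x - g21 0 0| + `|x - g12 0 0|.
  rewrite (_ : g12 0 0 - g21 0 0 = (x - g21 0 0) - (x - g12 0 0)); last by ring.
  exact: ler_normB.
by lra.
Qed.

Section Schwarz.
Context {R : realType} {V : normedModType R[i]}.
Implicit Types (f g : V -> C R) (v w p : V) (D : set V).

(** Directional derivatives are taken at parameter 0 of a line through the point, while the mean
    value theorem needs them all along a segment. *)
Lemma is_derive_translate (h : R -> R) (s x : R) :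
  is_derive (0 : R) (1 : R) (fun t => h (s + t)) x -> is_derive s (1 : R) h x.
Proof.
move=> [dh hx].
have E :
    (fun k : R => k^-1 *: (((fun t => h (s + t)) \o shift 0) (k *: 1) - h (s + 0))) =
    (fun k : R => k^-1 *: ((h \o shift s) (k *: 1) - h s)).
  by apply/funext => k; rewrite /= !addr0 [s + _]addrC.
by split; [move: dh; rewrite /derivable E|move: hx; rewrite /derive E].
Qed.

Lemma normc_ge_Im (x : C R) : (`|complex.Im x|)%:C%C <= `|x|.
Proof.
have i1 : `|'i%C : R[i]| = 1 by rewrite normc_def /= expr0n expr1n add0r sqrtr1.
have := normc_ge_Re ((x : R[i]) * 'i%C).
by rewrite ReiNIm normrN normrM i1 mulr1.
Qed.

Lemma real_derive_comm D f v w p : open D -> smooth_on D f -> D p ->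
  real_derive v (real_derive w f) p = real_derive w (real_derive v f) p.
Proof.
move=> oD fs Dp.
(* The real and the imaginary part enter only through two properties: they do not increase
   distances, and they commute with directional derivatives. *)
have part (pi : C R -> R) :
  (forall (x y : C R), `|pi x - pi y|%:C%C <= `|x - y|) ->
  (forall g u q, real_derivable u g q ->
     is_derive (0 : R) (1 : R) (fun t : R => pi (g (q + t%:C%C *: u)))
       (pi (real_derive u g q))) ->
  pi (real_derive v (real_derive w f) p) = pi (real_derive w (real_derive v f) p).
  move=> pi_le pi_der.
  have nD : nbhs p D by apply: open_nbhs_nbhs.
  have [d d0 dD] := line_near v w nD.
  pose at_ (h : V -> C R) (s t : R) := pi (h (p + s%:C%C *: v + t%:C%C *: w)).
  have der_w h (s t : R) : (forall q, D q -> real_derivable w h q) ->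
      `|s| < d -> `|t| < d ->
      is_derive t (1 : R) (at_ h s) (at_ (real_derive w h) s t).
    move=> hd sd td; apply: is_derive_translate.
    have := pi_der h w _ (hd _ (dD s t sd td)).
    by congr (is_derive _ _ _ _); apply/funext => x;
      rewrite /at_ rmorphD scalerDl !addrA.
  have der_v h (s t : R) : (forall q, D q -> real_derivable v h q) ->
      `|s| < d -> `|t| < d ->
      is_derive s (1 : R) ((at_ h)^~ t) (at_ (real_derive v h) s t).
    move=> hd sd td; apply: is_derive_translate.
    have := pi_der h v _ (hd _ (dD s t sd td)).
    by congr (is_derive _ _ _ _); apply/funext => x;
      rewrite /at_ rmorphD scalerDl !addrA
      -!(addrAC _ (t%:C%C *: w)).
  have sm vs u q : D q -> real_derivable u (foldr real_derive f vs) q.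
    by move=> Dq; have [_] := fs vs q Dq; apply.
  have at0 h : at_ h 0 0 = pi (h p) by rewrite /at_ rmorph0 !scale0r !addr0.
  suff E : at_ (real_derive w (real_derive v f)) 0 0 =
      at_ (real_derive v (real_derive w f)) 0 0.
    exact: (etrans (esym (at0 _)) (etrans (esym E) (at0 _))).
  apply: (@mixed_partials R (at_ f) (at_ (real_derive v f)) (at_ (real_derive w f))
    (at_ (real_derive w (real_derive v f)))
    (at_ (real_derive v (real_derive w f))) d d0).
  - by move=> s t; apply: der_v => q; exact: (sm [::]).
  - by move=> s t; apply: der_w => q; exact: (sm [:: v]).
  - by move=> s t; apply: der_w => q; exact: (sm [::]).
  - by move=> s t; apply: der_v => q; exact: (sm [:: w]).
  move=> e e0.
  have e0' : 0 < e%:C%C by rewrite ltcR.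
  have [/cvgrPdist_lt/(_ _ e0') n1 _] := fs [:: w; v] p Dp.
  have [/cvgrPdist_lt/(_ _ e0') n2 _] := fs [:: v; w] p Dp.
  have [r r0 rP] := line_near v w (filterI n1 n2).
  exists r => // s t sr tr; have [/= a b] := rP s t sr tr.
  split; rewrite at0 distrC -ltcR /at_.
    exact: (le_lt_trans (pi_le _ _) a).
  exact: (le_lt_trans (pi_le _ _) b).
have ReB (a b : C R) : complex.Re a - complex.Re b = complex.Re (a - b).
  by case: a b => ? ? [].
have ImB (a b : C R) : complex.Im a - complex.Im b = complex.Im (a - b).
  by case: a b => ? ? [].
have eR := part (@complex.Re R)
  (fun x y => eq_ind_r (fun z => (`|z|)%:C%C <= _) (normc_ge_Re _) (ReB x y))
  (fun g u q h => (real_derivableP h).1).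
have eI := part (@complex.Im R)
  (fun x y => eq_ind_r (fun z => (`|z|)%:C%C <= _) (normc_ge_Im _) (ImB x y))
  (fun g u q h => (real_derivableP h).2).
move: eR eI; case: (real_derive v _ p) => a b; case: (real_derive w _ p) => a' b' /=.
by move=> -> ->.
Qed.

End Schwarz.

(** * Derivations of smooth functions *)

Section Smooth.
Context {R : realType} {V : normedModType R[i]}.
Variables (D : set V) (oD : open D).
Implicit Types (f g : V -> C R) (v w p : V).

Lemma smooth_derive v f : smooth_on D f -> smooth_on D (real_derive v f).
Proof. by rewrite !Ck_smooth => fs k; have [_] := fs k.+1; exact. Qed.

Lemma smooth_ext f g : (forall p, D p -> f p = g p) -> smooth_on D f -> smooth_on D g.
Proof. by rewrite !Ck_smooth => fg fs k; exact: Ck_ext (fs k). Qed.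

Lemma smooth_cst (x : C R) : smooth_on D (fun=> x).
Proof. by rewrite Ck_smooth => k; exact: Ck_cst. Qed.

Lemma smoothD f g : smooth_on D f -> smooth_on D g -> smooth_on D (fun q => f q + g q).
Proof. by rewrite !Ck_smooth => fs gs k; exact: CkD. Qed.

Lemma smoothM f g : smooth_on D f -> smooth_on D g -> smooth_on D (fun q => f q * g q).
Proof. by rewrite !Ck_smooth => fs gs k; exact: CkM. Qed.

Lemma smoothV f : (forall p, D p -> f p != 0) -> smooth_on D f ->
  smooth_on D (fun q => (f q)^-1).
Proof. by rewrite !Ck_smooth => f0 fs k; exact: CkV. Qed.

Lemma smooth_conj f : smooth_on D f -> smooth_on D (fun q => conjc (f q)).
Proof. by rewrite !Ck_smooth => fs k; exact: Ck_conj. Qed.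

Lemma smoothN f : smooth_on D f -> smooth_on D (fun q => - f q).
Proof.
move=> fs; apply: smooth_ext (smoothM (smooth_cst (-1)) fs) => p _; exact: mulN1r.
Qed.

Lemma smooth_sum (I : Type) (r : seq I) (P : pred I) (F : I -> V -> C R) :
  (forall i, P i -> smooth_on D (F i)) ->
  smooth_on D (fun q => \sum_(i <- r | P i) F i q).
Proof.
move=> Fs; elim: r => [|i r IH].
  by apply: smooth_ext (smooth_cst 0) => q _; rewrite big_nil.
case Pi: (P i).
  by apply: smooth_ext (smoothD (Fs i Pi) IH) => q _; rewrite big_cons Pi.
by apply: smooth_ext IH => q _; rewrite big_cons Pi.
Qed.

Lemma smooth_prod (I : Type) (r : seq I) (P : pred I) (F : I -> V -> C R) :
  (forall i, P i -> smooth_on D (F i)) ->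
  smooth_on D (fun q => \prod_(i <- r | P i) F i q).
Proof.
move=> Fs; elim: r => [|i r IH].
  by apply: smooth_ext (smooth_cst 1) => q _; rewrite big_nil.
case Pi: (P i).
  by apply: smooth_ext (smoothM (Fs i Pi) IH) => q _; rewrite big_cons Pi.
by apply: smooth_ext IH => q _; rewrite big_cons Pi.
Qed.

Lemma smooth_det m (A : V -> 'M[C R]_m) :
  (forall a b, smooth_on D (fun q => A q a b)) -> smooth_on D (fun q => \det (A q)).
Proof.
move=> As; apply: smooth_sum => s _; apply: smoothM; first exact: smooth_cst.
by apply: smooth_prod => i _; exact: As.
Qed.

Lemma smooth_invmx m (A : V -> 'M[C R]_m) :
  (forall q, D q -> A q \in unitmx) ->
  (forall a b, smooth_on D (fun q => A q a b)) ->
  forall a b, smooth_on D (fun q => invmx (A q) a b).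
Proof.
move=> Au As a b.
(* Cramer's formula, valid on [D] only: at a singular matrix [invmx] returns its argument. *)
apply: (@smooth_ext (fun q => (\det (A q))^-1 * cofactor (A q) b a)) => [q Dq|].
  by rewrite /invmx Au // !mxE.
apply: smoothM.
  by apply: smoothV (smooth_det As) => q /Au; rewrite unitmxE unitfE.
apply: smoothM; first exact: smooth_cst.
apply: smooth_det => c d.
by apply: smooth_ext (As _ _) => q _; rewrite !mxE.
Qed.

Implicit Types d e : (V -> C R) -> (V -> C R).

(** [der_ext] is locality: the operators act on total functions of which only the values on [D]
    matter. Sum and product rules are restricted to smooth functions because directional derivatives
    obey them only where the derivatives exist. *)
Record derivation_on d : Prop := DerivationOn {
  der_smooth : forall f, smooth_on D f -> smooth_on D (d f) ;
  der_ext : forall f g, (forall p, D p -> f p = g p) ->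
    forall p, D p -> d f p = d g p ;
  der_cst : forall (x : C R) p, D p -> d (fun=> x) p = 0 ;
  derD : forall f g, smooth_on D f -> smooth_on D g -> forall p, D p ->
    d (fun q => f q + g q) p = d f p + d g p ;
  derM : forall f g, smooth_on D f -> smooth_on D g -> forall p, D p ->
    d (fun q => f q * g q) p = d f p * g p + f p * d g p
}.

Lemma real_derive_derivation v : derivation_on (real_derive v).
Proof.
split.
- exact: smooth_derive.
- move=> f g fg p Dp; apply: (near_real_derive v _).1.
  by apply: filterS (open_nbhs_nbhs (conj oD Dp)) => q /fg.
- by move=> x p _; exact: has_real_derive_val (has_real_derive_cst _ _ _).
- by move=> f g /Ck_smooth/(_ 0%N) f0 /Ck_smooth/(_ 0%N) g0 p; exact: real_deriveD f0 g0.
- by move=> f g /Ck_smooth/(_ 0%N) f0 /Ck_smooth/(_ 0%N) g0 p; exact: real_deriveM f0 g0.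
Qed.

Lemma derivation_scale (a : V -> C R) d : smooth_on D a -> derivation_on d ->
  derivation_on (fun f p => a p * d f p).
Proof.
move=> sa dd; split.
- by move=> f /(der_smooth dd); exact: smoothM.
- by move=> f g fg p Dp; rewrite (der_ext dd fg Dp).
- by move=> x p Dp; rewrite (der_cst dd) // mulr0.
- by move=> f g fs gs p Dp; rewrite (derD dd) // mulrDr.
- by move=> f g fs gs p Dp; rewrite (derM dd) //; ring.
Qed.

Lemma derivation_add d e : derivation_on d -> derivation_on e ->
  derivation_on (fun f p => d f p + e f p).
Proof.
move=> dd de; split.
- by move=> f fs; apply: smoothD; exact: der_smooth.
- by move=> f g fg p Dp; rewrite (der_ext dd fg Dp) (der_ext de fg Dp).
- by move=> x p Dp; rewrite (der_cst dd) // (der_cst de) // addr0.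
- by move=> f g fs gs p Dp; rewrite (derD dd) // (derD de) // addrACA.
- by move=> f g fs gs p Dp; rewrite (derM dd) // (derM de) //; ring.
Qed.

Lemma derivation_eq d e : (forall f p, d f p = e f p) -> derivation_on d -> derivation_on e.
Proof. by move=> de; rewrite (_ : d = e) //; apply/funext => f; apply/funext. Qed.

Lemma derivation_sub d e : derivation_on d -> derivation_on e ->
  derivation_on (fun f p => d f p - e f p).
Proof.
move=> dd de; apply: derivation_eq (derivation_add dd (derivation_scale (smooth_cst (-1)) de)).
by move=> f p; rewrite mulN1r.
Qed.

Lemma derivation0 : derivation_on (fun _ _ => 0).
Proof.
split.
- by move=> f _; exact: smooth_cst.
- by [].
- by [].
- by move=> f g _ _ p _; rewrite addr0.
- by move=> f g _ _ p _; rewrite mulr0 mul0r addr0.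
Qed.

Lemma derivation_sum (I : Type) (r : seq I) (F : I -> (V -> C R) -> (V -> C R)) :
  (forall i, derivation_on (F i)) -> derivation_on (fun f p => \sum_(i <- r) F i f p).
Proof.
move=> dF; elim: r => [|i r IH].
  by apply: derivation_eq derivation0 => f p; rewrite big_nil.
by apply: derivation_eq (derivation_add (dF i) IH) => f p; rewrite big_cons.
Qed.

Lemma der_sum d (I : Type) (r : seq I) (P : pred I) (F : I -> V -> C R) p :
  derivation_on d -> (forall i, P i -> smooth_on D (F i)) -> D p ->
  d (fun q => \sum_(i <- r | P i) F i q) p = \sum_(i <- r | P i) d (F i) p.
Proof.
move=> dd Fs Dp; elim: r => [|i r IH].
  rewrite big_nil; apply: etrans (der_cst dd 0 Dp).
  by apply: (der_ext dd) => // q _; rewrite big_nil.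
rewrite big_cons -IH; case Pi: (P i); last first.
  by apply: (der_ext dd) => // q _; rewrite big_cons Pi.
rewrite -(derD dd) //; [|exact: Fs|exact: smooth_sum].
by apply: (der_ext dd) => // q _; rewrite big_cons Pi.
Qed.

Lemma derZ d (x : C R) f p : derivation_on d -> smooth_on D f -> D p ->
  d (fun q => x * f q) p = x * d f p.
Proof.
move=> dd fs Dp; rewrite (derM dd (smooth_cst x) fs Dp).
by rewrite (der_cst dd _ Dp) mul0r add0r.
Qed.

Lemma derN d f p : derivation_on d -> smooth_on D f -> D p ->
  d (fun q => - f q) p = - d f p.
Proof.
move=> dd fs Dp; rewrite -mulN1r -(derZ _ dd) //.
by apply: (der_ext dd) => // q _; rewrite mulN1r.
Qed.

Lemma derB d f g p : derivation_on d -> smooth_on D f -> smooth_on D g -> D p ->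
  d (fun q => f q - g q) p = d f p - d g p.
Proof.
move=> dd fs gs Dp; rewrite (derD dd fs (smoothN gs) Dp).
by rewrite (derN dd gs Dp).
Qed.

Definition commute_on d e := forall f, smooth_on D f -> forall p, D p ->
  d (e f) p = e (d f) p.

Lemma commute_sym d e : commute_on d e -> commute_on e d.
Proof. by move=> de f fs p Dp; rewrite de. Qed.

Lemma commute_lincomb d d1 d2 (x y : C R) :
  derivation_on d -> derivation_on d1 -> derivation_on d2 ->
  commute_on d d1 -> commute_on d d2 ->
  commute_on d (fun f p => x * d1 f p + y * d2 f p).
Proof.
move=> dd dd1 dd2 c1 c2 f fs p Dp.
have s1 := der_smooth dd1 fs; have s2 := der_smooth dd2 fs.
rewrite (derD dd (smoothM (smooth_cst x) s1) (smoothM (smooth_cst y) s2) Dp).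
by rewrite (derZ x dd s1 Dp) (derZ y dd s2 Dp) (c1 f fs p Dp) (c2 f fs p Dp).
Qed.

Lemma wirtingerE v f p : wirtinger v f p =
  2^-1 * real_derive v f p + (- (2^-1 * 'i%C)) * real_derive ('i%C *: v) f p.
Proof. by rewrite /wirtinger mulrBr mulNr mulrA. Qed.

Lemma wirtinger_barE v f p : wirtinger_bar v f p =
  2^-1 * real_derive v f p + (2^-1 * 'i%C) * real_derive ('i%C *: v) f p.
Proof. by rewrite /wirtinger_bar mulrDr mulrA. Qed.

Lemma lincomb_derivation (x y : C R) d e : derivation_on d -> derivation_on e ->
  derivation_on (fun f p => x * d f p + y * e f p).
Proof.
by move=> dd de; apply: derivation_add; apply: derivation_scale => //; exact: smooth_cst.
Qed.

Lemma wirtinger_derivation v : derivation_on (wirtinger v).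
Proof.
apply: derivation_eq (lincomb_derivation 2^-1 (- (2^-1 * 'i%C))
  (real_derive_derivation v) (real_derive_derivation _)) => f p.
by rewrite wirtingerE.
Qed.

Lemma wirtinger_bar_derivation v : derivation_on (wirtinger_bar v).
Proof.
apply: derivation_eq (lincomb_derivation 2^-1 (2^-1 * 'i%C)
  (real_derive_derivation v) (real_derive_derivation _)) => f p.
by rewrite wirtinger_barE.
Qed.

Lemma commute_real_derive v w : commute_on (real_derive v) (real_derive w).
Proof. by move=> f fs p Dp; exact: (real_derive_comm v w oD fs Dp). Qed.

Lemma commute_eq d e e' : (forall f p, e f p = e' f p) ->
  commute_on d e -> commute_on d e'.
Proof. by move=> ee; rewrite (_ : e = e') //; apply/funext => f; apply/funext. Qed.

Lemma commute_wirtinger_r d v : derivation_on d ->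
  (forall w, commute_on d (real_derive w)) -> commute_on d (wirtinger v).
Proof.
move=> dd dw; apply: (commute_eq (fun f p => esym (wirtingerE v f p))).
exact: (commute_lincomb _ _ dd (real_derive_derivation _) (real_derive_derivation _)
  (dw _) (dw _)).
Qed.

Lemma commute_wirtinger_bar_r d v : derivation_on d ->
  (forall w, commute_on d (real_derive w)) -> commute_on d (wirtinger_bar v).
Proof.
move=> dd dw; apply: (commute_eq (fun f p => esym (wirtinger_barE v f p))).
exact: (commute_lincomb _ _ dd (real_derive_derivation _) (real_derive_derivation _)
  (dw _) (dw _)).
Qed.

Lemma commute_wirtinger v w : commute_on (wirtinger v) (wirtinger w).
Proof.
apply: commute_wirtinger_r => [|u]; first exact: wirtinger_derivation.
(* Reducing the other operator in the same way leaves two real directions, where the symmetry of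
   second derivatives applies. *)
apply: commute_sym; apply: commute_wirtinger_r => [|u'].
  exact: real_derive_derivation.
exact: commute_real_derive.
Qed.

Lemma commute_wirtinger_bar v w : commute_on (wirtinger_bar v) (wirtinger_bar w).
Proof.
apply: commute_wirtinger_bar_r => [|u]; first exact: wirtinger_bar_derivation.
apply: commute_sym; apply: commute_wirtinger_bar_r => [|u'].
  exact: real_derive_derivation.
exact: commute_real_derive.
Qed.

(** * Fields adapted to a nonlinear connection *)

Section Connection.
Variables (I A : finType).
Variables (X : I -> (V -> C R) -> (V -> C R)) (Y : A -> (V -> C R) -> (V -> C R)).
Variable (N : A -> I -> V -> C R).
Hypotheses (dX : forall k, derivation_on (X k)) (dY : forall a, derivation_on (Y a)).
Hypotheses (XX : forall j k, commute_on (X j) (X k))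
  (XY : forall k a, commute_on (X k) (Y a))
  (YY : forall a b, commute_on (Y a) (Y b)).
Hypothesis Ns : forall a k, smooth_on D (N a k).

(** Abstract in [X], [Y] and [N] so as to cover both the fields delta_k and their conjugates. *)
Definition adapted k f p := X k f p - \sum_a N a k p * Y a f p.

Lemma adapted_derivation k : derivation_on (adapted k).
Proof.
apply: (derivation_sub (dX k)); apply: derivation_sum => a.
exact: (derivation_scale (Ns a k) (dY a)).
Qed.

(** The expansion is arranged for antisymmetrization in [j] and [k]: the first and the last term are
    symmetric, the second and the fourth are exchanged, and only the derivatives of the coefficients
    survive. *)
Lemma adapted_adapted j k f p : smooth_on D f -> D p ->
  adapted j (adapted k f) p =
  X j (X k f) p - \sum_a N a j p * Y a (X k f) p
  - \sum_b adapted j (N b k) p * Y b f p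
  - \sum_b N b k p * X j (Y b f) p
  + \sum_b \sum_a N b k p * (N a j p * Y a (Y b f) p).
Proof.
move=> fs Dp; have dj := adapted_derivation j.
have NYs b := smoothM (Ns b k) (der_smooth (dY b) fs).
rewrite {2}/adapted.
rewrite (derB dj (der_smooth (dX k) fs) (smooth_sum _ (fun b _ => NYs b)) Dp).
rewrite (der_sum _ dj (fun b _ => NYs b) Dp).
have -> : \sum_b adapted j (fun q => N b k q * Y b f q) p =
    \sum_b adapted j (N b k) p * Y b f p + \sum_b N b k p * X j (Y b f) p
    - \sum_b \sum_a N b k p * (N a j p * Y a (Y b f) p).
  rewrite -big_split -sumrB /=; apply: eq_bigr => b _.
  rewrite (derM dj (Ns b k) (der_smooth (dY b) fs) Dp).
  by rewrite [adapted j (Y b f) p]/adapted mulrBr mulr_sumr addrA.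
rewrite [adapted j (X k f) p]/adapted; ring.
Qed.

(* [adapted_j, adapted_k] has no X-component; its Y-component is the curvature of N. *)
Lemma adapted_bracket j k f p : smooth_on D f -> D p ->
  adapted j (adapted k f) p - adapted k (adapted j f) p =
  - \sum_b (adapted j (N b k) p - adapted k (N b j) p) * Y b f p.
Proof.
move=> fs Dp; rewrite !adapted_adapted //.
have -> : \sum_b (adapted j (N b k) p - adapted k (N b j) p) * Y b f p =
  \sum_b adapted j (N b k) p * Y b f p - \sum_b adapted k (N b j) p * Y b f p.
  by rewrite -sumrB; apply: eq_bigr => b _; rewrite mulrBl.
rewrite XX //.
under [\sum_b N b j p * X k (Y b f) p]eq_bigr do rewrite XY //.
under [\sum_b N b k p * X j (Y b f) p]eq_bigr do rewrite XY //.
rewrite [X in _ - (_ + X)]exchange_big /=.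
under [X in _ - (_ + X)]eq_bigr => b _.
  under eq_bigr => a _ do rewrite YY // mulrCA.
  over.
ring.
Qed.

End Connection.
End Smooth.

(** * Exterior forms with smooth coefficients *)

Section ExteriorGenerators.
Context {K : comNzRingType} {N : nat}.
Implicit Types (S : {set 'I_N}) (u v : exterior K N).

(** Only the subset consisting of [i] alone contributes, and its inversions against the rest of [S]
    are the elements of [S] below [i]. *)
Lemma ext_gen_mulE i u S :
  (ext_gen i * u) S =
  if i \in S then (-1) ^+ #|[set l in S | (l < i)%N]| * u (S :\ i)%SET else 0.
Proof.
rewrite ffunE; case: ifPn => iS; last first.
  rewrite big1 // => A AS; rewrite ffunE; case: eqP => [A1|_].
    by move: AS; rewrite A1 finset.sub1set (negPf iS).
  by rewrite mul0r mulr0.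
rewrite (bigD1 [set i]%SET) ?finset.sub1set //= big1 ?addr0; last first.
  by move=> A /andP[_ /negPf A1]; rewrite ffunE A1 mul0r mulr0.
rewrite ffunE eqxx mul1r /inversions big_set1 -big_mkcondr sum1_card.
congr (_ ^+ _ * _); apply: eq_card => l; rewrite !inE.
by rewrite unfold_in /= !inE; case: (l =P i) => [->|_]; rewrite ?ltnn ?andbF.
Qed.

Lemma ext_gen_anticomm (i j : 'I_N) :
  ext_gen i * ext_gen j = - (ext_gen j * ext_gen i) :> exterior K N.
Proof.
have ne (a b : 'I_N) S : S != [set a; b]%SET ->
    (ext_gen a * ext_gen b : exterior K N) S = 0.
  move=> Sab; rewrite ext_gen_mulE; case: ifP => // aS; rewrite ffunE.
  case: eqP => [Sb|_]; last by rewrite mulr0.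
  by case/eqP: Sab; rewrite -(finset.setD1K aS) Sb.
apply/ffunP => S; rewrite [RHS]ffunE.
have [->|Sij] := eqVneq S [set i; j]%SET; last first.
  by rewrite !ne ?oppr0 // finset.setUC.
rewrite !ext_gen_mulE !inE !eqxx orbT /= !ffunE.
have [->|ij] := eqVneq i j.
  have -> : ([set j; j] :\ j == [set j])%SET = false.
    by apply/eqP => /setP/(_ j); rewrite !inE eqxx.
  by rewrite mulr0 oppr0.
have -> : ([set i; j] :\ i = [set j])%SET.
  apply/setP => l; rewrite !inE; case: (l =P i) => //= ->.
  by rewrite (negPf ij).
have -> : ([set i; j] :\ j = [set i])%SET.
  apply/setP => l; rewrite !inE; case: (l =P j) => [->|_] /=; last by rewrite orbF.
  by rewrite eq_sym (negPf ij).
rewrite !eqxx !mulr1.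
(* The position of [a] in the pair is 1 or 0 according to whether [b] lies below it, so the two
   orders carry opposite signs. *)
have cardE (a b : 'I_N) : (#|[set l in [set a; b] | (l < a)%N]|)%SET = (b < a)%N.
  rewrite -sum1_card (eq_bigl (fun l => (l == b) && (b < a)%N)).
    by rewrite big_mkcondr big_pred1_eq; case: (_ < _)%N.
  move=> l; rewrite !inE; case: (l =P b) => [->|_]; first by rewrite orbT.
  by rewrite orbF; case: (l =P a) => //= ->; rewrite ltnn.
rewrite cardE (_ : [set i; j]%SET = [set j; i]%SET) ?cardE; last by rewrite finset.setUC.
case: (ltngtP i j) => [||/val_inj/eqP]; rewrite ?expr0 ?expr1 ?opprK //.
by rewrite (negPf ij).
Qed.

End ExteriorGenerators.

Section HorizontalAlgebra.
Context {K : comNzRingType} {n : nat}.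
Implicit Types (S : {set 'I_(n + n)}) (u v : exterior K (n + n)).

(** Two sign changes cancel. This commutation is what stands in for evenness of degree. *)
Lemma dzbar_comm_dz_dzbar (j k l : 'I_n) :
  GRing.comm (dzbar l) (dz j * dzbar k : exterior K (n + n)).
Proof.
rewrite /GRing.comm mulrA [dzbar l * dz j]ext_gen_anticomm mulNr -(mulrA (ext_gen _)).
by rewrite [dzbar l * dzbar k]ext_gen_anticomm mulrN opprK mulrA.
Qed.

Lemma dzbar_swap (j k l : 'I_n) :
  dzbar k * (dz j * dzbar l) = - (dzbar l * (dz j * dzbar k)) :> exterior K (n + n).
Proof.
rewrite !dzbar_comm_dz_dzbar -!mulrA [dzbar l * dzbar k]ext_gen_anticomm.
by rewrite mulrN.
Qed.

Lemma comm_scaler (a : K) u v : GRing.comm u v -> GRing.comm u (a *: v).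
Proof. by move=> uv; rewrite /GRing.comm -scalerAr uv scalerAl. Qed.

(** The [dz] generators precede all [dzbar] generators, so the position of [dzbar k] in [S] is the
    holomorphic degree plus its position among the antiholomorphic indices. This is the origin of
    the factor [(-1)^p] in d''h. *)
Lemma card_below_rshift S (k : 'I_n) :
  #|[set l in S | (l < rshift n k)%N]| =
  (#|holo_part S| + #|[set l in anti_part S | (l < k)%N]%SET|)%N.
Proof.
rewrite -!sum1_card big_split_ord /=; congr (_ + _)%N.
  by apply: eq_bigl => l; rewrite !inE /= ltn_addr // andbT.
by apply: eq_bigl => l; rewrite !inE /= ltn_add2l.
Qed.

End HorizontalAlgebra.

Section ExteriorForms.
Context {R : realType} {V : normedModType R[i]}.
Variables (D : set V) (oD : open D).
Section CoefficientDerivative.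
Variable N : nat.
Implicit Types (phi psi : V -> exterior (C R) N) (p : V) (d : (V -> C R) -> (V -> C R)).

Definition ext_smooth phi := forall S, smooth_on D (fun q => phi q S).

Definition coef_der d phi p : exterior (C R) N := [ffun S => d (fun q => phi q S) p].

Lemma ext_smooth_cst (u : exterior (C R) N) : ext_smooth (fun=> u).
Proof. by move=> S; exact: smooth_cst. Qed.

Lemma ext_smoothD phi psi : ext_smooth phi -> ext_smooth psi ->
  ext_smooth (fun q => phi q + psi q).
Proof.
move=> sphi spsi S; apply: (smooth_ext oD _ (smoothD oD (sphi S) (spsi S))) => q _.
by rewrite ffunE.
Qed.

Lemma ext_smoothZ (a : V -> C R) phi : smooth_on D a -> ext_smooth phi ->
  ext_smooth (fun q => a q *: phi q).
Proof.
move=> sa sphi S; apply: (smooth_ext oD _ (smoothM oD sa (sphi S))) => q _.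
by rewrite ffunE.
Qed.

Lemma ext_smoothM phi psi : ext_smooth phi -> ext_smooth psi ->
  ext_smooth (fun q => phi q * psi q).
Proof.
move=> sphi spsi S.
have H := @smooth_sum _ _ _ oD _ (index_enum {set 'I_N}) (fun A => A \subset S)
  (fun A q => (-1) ^+ inversions A (S :\: A)%SET * (phi q A * psi q (S :\: A)%SET)).
apply: (smooth_ext oD _ (H _)) => [q _|A _]; first by rewrite ffunE.
by apply: smoothM => //; [exact: smooth_cst|exact: smoothM].
Qed.

Lemma ext_smooth_sum (I : Type) (r : seq I) (P : pred I) (F : I -> V -> exterior (C R) N) :
  (forall i, P i -> ext_smooth (F i)) ->
  ext_smooth (fun q => \sum_(i <- r | P i) F i q).
Proof.
move=> Fs S; have H := @smooth_sum _ _ _ oD _ r P (fun i q => F i q S).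
apply: (smooth_ext oD _ (H _)) => [q _|i Pi]; last exact: Fs.
by rewrite sum_ffunE.
Qed.

Variable d : (V -> C R) -> (V -> C R).
Hypothesis dd : derivation_on D d.

Lemma coef_der_cst (u : exterior (C R) N) p : D p -> coef_der d (fun=> u) p = 0.
Proof. by move=> Dp; apply/ffunP => S; rewrite !ffunE (der_cst dd). Qed.

Lemma coef_derD phi psi p : ext_smooth phi -> ext_smooth psi -> D p ->
  coef_der d (fun q => phi q + psi q) p = coef_der d phi p + coef_der d psi p.
Proof.
move=> sphi spsi Dp; apply/ffunP => S; rewrite !ffunE -(derD dd) //.
by apply: (der_ext dd) => // q _; rewrite ffunE.
Qed.

Lemma coef_der_sum (I : Type) (r : seq I) (P : pred I) (F : I -> V -> exterior (C R) N) p :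
  (forall i, P i -> ext_smooth (F i)) -> D p ->
  coef_der d (fun q => \sum_(i <- r | P i) F i q) p =
  \sum_(i <- r | P i) coef_der d (F i) p.
Proof.
move=> Fs Dp; apply/ffunP => S; rewrite sum_ffunE ffunE.
under [RHS]eq_bigr do rewrite ffunE.
rewrite -(der_sum oD _ dd) //; last by move=> i /Fs.
by apply: (der_ext dd) => // q _; rewrite sum_ffunE.
Qed.

Lemma coef_derZ (a : V -> C R) (u : exterior (C R) N) p : smooth_on D a -> D p ->
  coef_der d (fun q => a q *: u) p = d a p *: u.
Proof.
move=> sa Dp; apply/ffunP => S; rewrite !ffunE.
transitivity (d (fun q => a q * u S) p).
  by apply: (der_ext dd) => // q _; rewrite ffunE.
rewrite (derM dd sa (smooth_cst (u S)) Dp).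
by rewrite (der_cst dd _ Dp) mulr0 addr0.
Qed.

(** The signs of the wedge product are constants, so no grading sign appears; one could arise only
    when a [dzbar k] is moved past [phi]. *)
Lemma coef_derM phi psi p : ext_smooth phi -> ext_smooth psi -> D p ->
  coef_der d (fun q => phi q * psi q) p =
  coef_der d phi p * psi p + phi p * coef_der d psi p.
Proof.
move=> sphi spsi Dp; apply/ffunP => S; rewrite !ffunE -big_split /=.
transitivity (d (fun q => \sum_(A : {set 'I_N} | A \subset S)
     (-1) ^+ inversions A (S :\: A)%SET * (phi q A * psi q (S :\: A)%SET)) p).
  by apply: (der_ext dd) => // q _; rewrite ffunE.
have s2 A : smooth_on D (fun q => phi q A * psi q (S :\: A)%SET) by exact: smoothM.
rewrite (der_sum oD _ dd) //; last first.
  by move=> A _; apply: smoothM => //; exact: smooth_cst.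
apply: eq_bigr => A _; rewrite !ffunE (derZ _ dd) // -mulrDr; congr (_ * _).
by rewrite (derM dd).
Qed.

End CoefficientDerivative.

Variables (n : nat) (del : 'I_n -> (V -> C R) -> (V -> C R)).
Hypothesis ddel : forall k, derivation_on D (del k).
Implicit Types (phi psi : V -> exterior (C R) (n + n)) (p : V).

Definition dbar_op phi p : exterior (C R) (n + n) :=
  \sum_k dzbar k * coef_der (del k) phi p.

(* On forms commuting with the dzbar^k, dbar_op satisfies the ungraded Leibniz rule. *)
Definition dbar_closed phi := [/\ ext_smooth phi,
  forall p, D p -> forall k, GRing.comm (dzbar k) (phi p) &
  forall p, D p -> dbar_op phi p = 0].

Lemma dbar_closed_cst (u : exterior (C R) (n + n)) :
  (forall k, GRing.comm (dzbar k) u) -> dbar_closed (fun=> u).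
Proof.
move=> cu; split => // [|p Dp]; first exact: ext_smooth_cst.
by rewrite /dbar_op big1 // => k _; rewrite (coef_der_cst (ddel k)) // mulr0.
Qed.

Lemma dbar_closedD phi psi : dbar_closed phi -> dbar_closed psi ->
  dbar_closed (fun q => phi q + psi q).
Proof.
move=> [s1 c1 d1] [s2 c2 d2]; split => [|p Dp k|p Dp].
- exact: ext_smoothD.
- by apply: commrD; [exact: c1|exact: c2].
- rewrite -[RHS]addr0 -{1}(d1 p Dp) -(d2 p Dp) -big_split /=.
  by apply: eq_bigr => k _; rewrite (coef_derD (ddel k)) // mulrDr.
Qed.

Lemma dbar_closedM phi psi : dbar_closed phi -> dbar_closed psi ->
  dbar_closed (fun q => phi q * psi q).
Proof.
move=> [s1 c1 d1] [s2 c2 d2]; split => [|p Dp k|p Dp].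
- exact: ext_smoothM.
- by apply: commrM; [exact: c1|exact: c2].
- transitivity (dbar_op phi p * psi p + phi p * dbar_op psi p); last first.
    by rewrite d1 // d2 // mul0r mulr0 addr0.
  rewrite /dbar_op mulr_suml mulr_sumr -big_split /=; apply: eq_bigr => k _.
  rewrite (coef_derM (ddel k)) // mulrDr !mulrA.
  by congr (_ + _ * _); exact: c1.
Qed.

Lemma dbar_closed_sum (I : Type) (r : seq I) (F : I -> V -> exterior (C R) (n + n)) :
  (forall i, dbar_closed (F i)) -> dbar_closed (fun q => \sum_(i <- r) F i q).
Proof.
move=> Fc; elim: r => [|i r IH].
  rewrite (_ : (fun q => _) = fun=> 0); last by apply/funext => q; rewrite big_nil.
  by apply: dbar_closed_cst => k; exact: commr0.
rewrite (_ : (fun q => _) = fun q => F i q + \sum_(j <- r) F j q); last first.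
  by apply/funext => q; rewrite big_cons.
exact: dbar_closedD.
Qed.

Lemma dbar_closed_prod (I : Type) (r : seq I) (F : I -> V -> exterior (C R) (n + n)) :
  (forall i, dbar_closed (F i)) -> dbar_closed (fun q => \prod_(i <- r) F i q).
Proof.
move=> Fc; elim: r => [|i r IH].
  rewrite (_ : (fun q => _) = fun=> 1); last by apply/funext => q; rewrite big_nil.
  by apply: dbar_closed_cst => k; exact: commr1.
rewrite (_ : (fun q => _) = fun q => F i q * \prod_(j <- r) F j q); last first.
  by apply/funext => q; rewrite big_cons.
exact: dbar_closedM.
Qed.

Lemma dbar_closedZ (a : C R) phi : dbar_closed phi -> dbar_closed (fun q => a *: phi q).
Proof.
move=> cphi; rewrite (_ : (fun q => _) = fun q => (a *: 1) * phi q); last first.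
  by apply/funext => q; rewrite -scalerAl mul1r.
apply: dbar_closedM cphi; apply: dbar_closed_cst => k.
by apply: comm_scaler; exact: commr1.
Qed.

Lemma dbar_closed_det m (M : V -> 'M[exterior (C R) (n + n)]_m) :
  (forall a b, dbar_closed (fun q => M q a b)) -> dbar_closed (fun q => \det (M q)).
Proof.
move=> Mc; apply: dbar_closed_sum => s; apply: dbar_closedM.
  by apply: dbar_closed_cst => k; apply/commrX/commrN/commr1.
by apply: dbar_closed_prod => i; exact: Mc.
Qed.

(* The form is dbar_op (\sum_j L_j dz^j), and dbar_op squares to zero. *)
Lemma dbar_closed_curvature (L : 'I_n -> V -> C R) :
  (forall k l, commute_on D (del k) (del l)) -> (forall j, smooth_on D (L j)) ->
  dbar_closed (fun q => \sum_j \sum_k (- del k (L j) q) *: (dz j * dzbar k)).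
Proof.
move=> comm_del Ls.
have sc j k : smooth_on D (fun q => - del k (L j) q).
  by apply: smoothN => //; apply: der_smooth.
have s1 j k :
    ext_smooth (fun q => (- del k (L j) q) *: (dz j * dzbar k : exterior (C R) (n + n))).
  by apply: ext_smoothZ => //; exact: ext_smooth_cst.
have s2 j : ext_smooth (fun q =>
    \sum_k (- del k (L j) q) *: (dz j * dzbar k : exterior (C R) (n + n))).
  by apply: ext_smooth_sum.
split => [|p Dp k|p Dp]; first exact: ext_smooth_sum.
  apply: commr_sum => j _; apply: commr_sum => l _.
  by apply: comm_scaler; exact: dzbar_comm_dz_dzbar.
rewrite /dbar_op.
transitivity (- \sum_j \sum_l \sum_k del l (del k (L j)) p *:
    (dzbar l * (dz j * dzbar k) : exterior (C R) (n + n))).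
  rewrite exchange_big /= -sumrN; apply: eq_bigr => l _.
  rewrite (coef_der_sum (ddel l)) // mulr_sumr -sumrN; apply: eq_bigr => j _.
  rewrite (coef_der_sum (ddel l)) // mulr_sumr -sumrN; apply: eq_bigr => k _.
  rewrite (coef_derZ (ddel l)) // -scalerAr (derN (ddel l)) ?scaleNr //.
  exact: der_smooth.
rewrite big1 ?oppr0 // => j _; set T := \sum_l _.
(* Exchanging [k] and [l] leaves the second derivative unchanged and reverses the sign of the
   covector. *)
have TN : T = - T.
  rewrite {1}/T exchange_big /= -sumrN; apply: eq_bigr => l _.
  rewrite -sumrN; apply: eq_bigr => k _; rewrite comm_del // -scalerN; congr (_ *: _).
  exact: dzbar_swap.
(* Vanishing is read off coefficientwise, in a field where 2 is invertible. *)
apply/ffunP => S; rewrite [RHS]ffunE.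
have TS : T S = - T S by rewrite [in LHS]TN ffunE.
by apply/eqP; move/eqP: TS; rewrite -addr_eq0 -mulr2n mulrn_eq0.
Qed.

End ExteriorForms.

(** * The Chern-Finsler connection *)

Section LocalChernForms.
Context {R : realType} {n m : nat}.
Variables (G : coords R n m -> C R) (D : set (coords R n m)).
Hypotheses (oD : open D) (Gs : smooth_on D G)
  (Gu : forall p, D p -> levi G p \in unitmx).
Implicit Types (f : coords R n m -> C R) (p : coords R n m).

Local Notation N := (chern_finsler G).

Lemma levi_smooth a b : smooth_on D (fun q => levi G q a b).
Proof.
apply: (smooth_ext oD (f := d_eta a (d_etabar b G))) => [q _|]; first by rewrite mxE.
apply: (der_smooth (wirtinger_derivation oD _)).
exact: (der_smooth (wirtinger_bar_derivation oD _)).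
Qed.

Lemma d_etabar_smooth c : smooth_on D (d_etabar c G).
Proof. exact: (der_smooth (wirtinger_bar_derivation oD _)). Qed.

Lemma chern_finsler_smooth a k : smooth_on D (N a k).
Proof.
apply: (smooth_sum oD) => c _.
apply: (smoothM oD (smooth_invmx oD Gu levi_smooth c a)).
exact: (der_smooth (wirtinger_derivation oD _) (d_etabar_smooth c)).
Qed.

Let delta k := adapted (@d_z R n m) (@d_eta R n m) N k.

Lemma delta_derivation k : derivation_on D (delta k).
Proof.
apply: (adapted_derivation oD) => [l|a|a l]; [exact: wirtinger_derivation..|].
exact: chern_finsler_smooth.
Qed.

(* Since the matrix d_eta a (d_etabar c G) is invertible, these equations
   characterize the Chern-Finsler coefficients. *)
Lemma delta_d_etabar k c p : D p -> delta k (d_etabar c G) p = 0.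
Proof.
move=> Dp; rewrite /delta /adapted; apply/eqP; rewrite subr_eq0; apply/eqP.
have := mulVmx (Gu Dp) => /matrixP LV.
transitivity (\sum_b (invmx (levi G p) *m levi G p) b c * d_z k (d_etabar b G) p).
  rewrite (bigD1 c) //= LV mxE eqxx mul1r big1 ?addr0 // => b bc.
  by rewrite LV mxE (negPf bc) mul0r.
transitivity (\sum_b \sum_a invmx (levi G p) b a * levi G p a c * d_z k (d_etabar b G) p).
  by apply: eq_bigr => b _; rewrite -mulr_suml; congr (_ * _); rewrite [LHS]mxE.
rewrite exchange_big /=; apply: eq_bigr => a _.
rewrite /chern_finsler mulr_suml; apply: eq_bigr => b _.
rewrite mulrAC; congr (_ * _); by rewrite [LHS]mxE.
Qed.

Lemma chern_finsler_flat j k b p : D p -> delta j (N b k) p = delta k (N b j) p.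
Proof.
move=> Dp; apply/eqP; rewrite -subr_eq0; apply/eqP.
pose B := \row_b (delta j (N b k) p - delta k (N b j) p).
suff B0 : B = 0 by have /matrixP/(_ 0 b) := B0; rewrite !mxE.
rewrite -(mulmxK (Gu Dp) B) (_ : B *m _ = 0) ?mul0mx //.
apply/matrixP => i c; rewrite !mxE.
(* Applied to [d_etabar c G], the right-hand side of the bracket formula is, up to sign, the entry
   [c] of [B *m levi G p]. *)
have := adapted_bracket oD (fun k => wirtinger_derivation oD (e_z k))
  (fun a => wirtinger_derivation oD (e_eta a))
  (fun j k => commute_wirtinger oD (e_z j) (e_z k))
  (fun j a => commute_wirtinger oD (e_z j) (e_eta a))
  (fun a b => commute_wirtinger oD (e_eta a) (e_eta b))
  chern_finsler_smooth j k (d_etabar_smooth c) Dp.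
rewrite -/(delta j) -/(delta k) => H.
(* The inner function vanishes on all of [D], not merely at [p], so locality allows it to be
   replaced by the constant 0. *)
have z0 i1 i2 : delta i1 (delta i2 (d_etabar c G)) p = 0.
  rewrite -[RHS](der_cst (delta_derivation i1) 0 Dp).
  by apply: (der_ext (delta_derivation i1)) => // q; exact: delta_d_etabar.
move: H; rewrite !z0 subr0 => /esym/eqP; rewrite oppr_eq0 => /eqP H.
rewrite -[RHS]H; apply: eq_bigr => a _.
by rewrite mxE [levi G p a c]mxE.
Qed.

(** * Passage to the conjugate fields *)

Lemma conjc2V : conjc (2^-1 : C R) = 2^-1.
Proof. by rewrite conjc_inv conjc_nat. Qed.

Lemma wirtinger_bar_conj v f p :
  wirtinger_bar v (fun q => conjc (f q)) p = conjc (wirtinger v f p).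
Proof.
rewrite /wirtinger_bar /wirtinger !real_derive_conj.
have conjM (x y : C R) : conjc (x * y) = conjc x * conjc y by exact: rmorphM.
have conjB (x y : C R) : conjc (x - y) = conjc x - conjc y by exact: rmorphB.
rewrite conjM conjB conjM conjc2V.
have -> : conjc 'i%C = - 'i%C :> C R by rewrite /= /GRing.opp /= oppr0.
by rewrite mulNr opprK.
Qed.

Lemma delta_bar_adapted k : delta_bar G k =
  adapted (@d_zbar R n m) (@d_etabar R n m) (fun a l q => conjc (N a l q)) k.
Proof. by apply/funext => f; apply/funext => p; rewrite delta_barE. Qed.

Lemma delta_bar_conj k f p :
  delta_bar G k (fun q => conjc (f q)) p = conjc (delta k f p).
Proof.
rewrite delta_barE /delta /adapted rmorphB rmorph_sum /d_zbar /d_etabar.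
rewrite wirtinger_bar_conj; congr (_ - _); apply: eq_bigr => a _.
by rewrite wirtinger_bar_conj; symmetry; exact: rmorphM.
Qed.

Lemma conj_chern_finsler_smooth a k : smooth_on D (fun q => conjc (N a k q)).
Proof. apply: (@smooth_conj _ _ D (N a k)); exact: chern_finsler_smooth. Qed.

Lemma delta_bar_derivation k : derivation_on D (delta_bar G k).
Proof.
rewrite delta_bar_adapted; apply: (adapted_derivation oD) => [l|a|a l];
  [exact: wirtinger_bar_derivation..|].
exact: conj_chern_finsler_smooth.
Qed.

(** The components of the bracket are the conjugates of those that [chern_finsler_flat] shows to
    vanish. *)
Lemma delta_bar_commute j k : commute_on D (delta_bar G j) (delta_bar G k).
Proof.
move=> f fs p Dp; apply/eqP; rewrite -subr_eq0; apply/eqP.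
rewrite !delta_bar_adapted.
rewrite (adapted_bracket oD (fun k => wirtinger_bar_derivation oD (e_z k))
  (fun a => wirtinger_bar_derivation oD (e_eta a))
  (fun j k => commute_wirtinger_bar oD (e_z j) (e_z k))
  (fun j a => commute_wirtinger_bar oD (e_z j) (e_eta a))
  (fun a b => commute_wirtinger_bar oD (e_eta a) (e_eta b))
  conj_chern_finsler_smooth j k fs Dp).
rewrite big1 ?oppr0 // => b _.
by rewrite -!delta_bar_adapted !delta_bar_conj chern_finsler_flat // subrr mul0r.
Qed.

(** * Closedness of the Chern forms in one chart *)

Lemma dbar_hE phi p : dbar_h G phi p = dbar_op (delta_bar G) phi p.
Proof.
apply/ffunP => S; rewrite ffunE /dbar_op sum_ffunE mulr_sumr big_mkcond /=.
apply: eq_bigr => k _; rewrite ext_gen_mulE inE; case: ifP => // _.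
by rewrite ffunE card_below_rshift exprD -mulrA.
Qed.

Lemma bott_coef_smooth a b j : smooth_on D (bott_coef G a b j).
Proof.
apply: (smooth_ext oD (f := d_eta b (N a j))) => [q _|]; first by rewrite bott_coefE.
apply: (der_smooth (wirtinger_derivation oD _)); exact: chern_finsler_smooth.
Qed.

Lemma curvature_closed a b : dbar_closed D (delta_bar G) (curvature G a b).
Proof.
exact: (dbar_closed_curvature oD delta_bar_derivation delta_bar_commute
  (bott_coef_smooth a b)).
Qed.

Lemma chern_det_closed : dbar_closed D (delta_bar G) (chern_det G).
Proof.
have dd := delta_bar_derivation.
apply: dbar_closed_det => // a b.
set c : C R := ((2 * pi)%:C%C * 'i%C)^-1.
rewrite (_ : (fun q => _) = fun q => (a == b)%:R + (- c) *: curvature G a b q); last first.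
  by apply/funext => q; rewrite !mxE scaleNr.
apply: dbar_closedD => //.
  by apply: dbar_closed_cst => // k; apply/commr_nat.
by apply: dbar_closedZ => //; exact: curvature_closed.
Qed.

(** The coefficient at [S] involves only those at [S] with one antiholomorphic index removed. As the
    operator intertwines the projections onto types, closedness of the whole determinant yields that
    of each component. *)
Lemma dbar_h_type_component r s phi p : D p ->
  dbar_h G (fun q => type_component r s (phi q)) p =
  type_component r s.+1 (dbar_h G phi p).
Proof.
move=> Dp; apply/ffunP => S; rewrite !ffunE.
have part k : k \in anti_part S ->
  (#|holo_part (S :\ rshift n k)%SET| == r) && (#|anti_part (S :\ rshift n k)%SET| == s)
  = (#|holo_part S| == r) && (#|anti_part S| == s.+1).
  move=> kS; congr (_ && _).
    by congr (_ == _); apply: eq_card => i; rewrite !inE eq_lrshift.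
  rewrite (cardsD1 k (anti_part S)) kS add1n eqSS; congr (_ == _).
  by apply: eq_card => i; rewrite !inE eq_rshift.
rewrite [X in _ = if _ then X else _](_ : _ = (-1) ^+ #|holo_part S| *
   \sum_(k in anti_part S)
       (-1) ^+ #|[set l in anti_part S | (l < k)%N]%SET| *
       delta_bar G k (fun q => phi q (S :\ rshift n k)%SET) p) //.
case: ifP => c.
  congr (_ * _); apply: eq_bigr => k kS; congr (_ * _).
  by apply: (der_ext (delta_bar_derivation k)) => // q _; rewrite ffunE part // c.
rewrite big1 ?mulr0 // => k kS.
rewrite (der_ext (delta_bar_derivation k) (g := fun=> 0)) //.
  by rewrite (der_cst (delta_bar_derivation k)) // mulr0.
by move=> q _; rewrite ffunE part // c.
Qed.

Lemma dbar_h_chern_form j p : D p -> dbar_h G (chern_form G j) p = 0.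
Proof.
move=> Dp; rewrite [LHS]dbar_h_type_component // dbar_hE.
have [_ _ ->//] := chern_det_closed.
by apply/ffunP => S; rewrite !ffunE if_same.
Qed.

End LocalChernForms.

(** * From the Finsler bundle to the local setting *)

Lemma posdef_unitmx (F : numClosedFieldType) (cj : F -> F) m (A : 'M[F]_m) :
  (forall xi : 'cV_m, xi != 0 -> 0 < \sum_a \sum_b A a b * xi a 0 * cj (xi b 0)) ->
  A \in unitmx.
Proof.
move=> Apos; rewrite unitmxE unitfE; apply/det0P => -[v v0 vA].
(* The form is linear in the slot of the row index, so a nonzero row vector annihilated by [A] makes
   it vanish at its transpose. *)
have := Apos v^T; rewrite -trmx0 (inj_eq trmx_inj) => /(_ v0).
rewrite exchange_big big1 ?ltxx // => b _.
under eq_bigr do rewrite mxE [A _ _ * _]mulrC.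
rewrite -mulr_suml; have /matrixP/(_ 0 b) := vA.
by rewrite !mxE => ->; rewrite mul0r.
Qed.

Lemma Estar_open (R : realType) (n m : nat)
    (E : holomorphicVectorBundle R n m) (c : chart E) :
  open (Estar c).
Proof.
rewrite (_ : Estar c = (fst @^-1` (zcoord c @` chart_dom c)) `&`
    (snd @^-1` (~` [set 0]))).
  apply: openI; apply: open_comp.
  - by move=> x _; exact: cvg_fst.
  - exact: zcoord_open.
  - by move=> x _; exact: cvg_snd.
  - rewrite openC; apply: accessible_closed_set1; apply: hausdorff_accessible.
    exact: norm_hausdorff.
apply/seteqP; split => p [zp /= p2]; split => //=; exact/eqP.
Qed.

Theorem mainTheorem4 (R : realType) (n m : nat)
    (E : complexFinslerBundle R n m) (j : nat) (hj : (j <= m)%N)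
    (c : chart E) (p : 'cV[R[i]^o]_n * 'cV[R[i]^o]_m) (hp : Estar c p) :
  dbar_hform E (chern_hform E j) c p = 0.
Proof.
apply: (@dbar_h_chern_form R n m (squared_local (@finsler R n m E) c) (Estar c)) => //.
- exact: Estar_open.
- exact: finsler_smooth.
- by move=> q /finsler_posdef; exact: posdef_unitmx.
Qed.
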